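(* Every well-typed closed term of the calculus $\lambda_{\mathrm{cES}}$ is strongly normalizing: if $R;\emptyset \vdash \mathbf{M} : (\alpha,e)$ is derivable (with $R$ a well-formed reference context and empty variable context), then there is no infinite reduction sequence $\mathbf{M}\to\mathbf{M}_1\to\mathbf{M}_2\to\cdots$.
   Context: The calculus $\lambda_{\mathrm{cES}}$ (concurrent call-by-value $\lambda$-calculus with explicit substitutions for variables and references). Variables $x,y,\dots$; references $r,s,\dots$. A variable substitution $\sigma$ is a finite partial map from variables to values; a reference substitution $\mathcal{V}$ is a finite partial map from references to finite multisets of values. Syntax: values $V ::= x \mid \ast \mid \lambda x.M$; terms $M ::= V \mid M\langle\sigma\rangle \mid (M\,M)[\mathcal{V}]_\lambda \mid \mathrm{get}(r) \mid M[\mathcal{V}]_\downarrow \mid M[\mathcal{V}]_\uparrow \mid M\parallel M$; sums $\mathbf{M} ::= \mathbf{0}\mid M \mid \mathbf{M}+\mathbf{M}$. Here $M\langle\sigma\rangle$ is an explicit variable substitution, $M[\mathcal V]_\downarrow$, $M[\mathcal V]_\uparrow$ are downward/upward reference substitutions and $(M\,N)[\mathcal V]_\lambda$ is an application carrying a $\lambda$-substitution; $(M\,N)$ abbreviates $(M\,N)[\emptyset]_\lambda$. Terms are taken modulo $\alpha$-equivalence and the structural equations: $\parallel$ is associative and commutative; $+$ is associative, commutative, idempotent, with neutral element $\mathbf 0$. Notations: $x\{\sigma\}=\sigma(x)$ if defined, else $x$; $\ast\{\sigma\}=\ast$; $(\lambda x.M)\{\sigma\}=\lambda x.(M\langle\sigma\rangle)$.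 $\mathcal V\{\sigma\}$ maps $r\mapsto[V\{\sigma\}\mid V\in\mathcal V(r)]$. $\mathcal U,\mathcal V$ is the reference substitution with $(\mathcal U,\mathcal V)(r)=\mathcal U(r)+\mathcal V(r)$ (multiset union) when both are defined, and the defined one otherwise. $(\sigma,\tau)(x)=\sigma(x)\{\tau\}$ if both defined, otherwise whichever is defined. Evaluation contexts: $E ::= [\cdot] \mid (E\,M)[\mathcal V]_\lambda \mid (M\,E)[\mathcal V]_\lambda \mid E[\mathcal V]_\downarrow \mid E[\mathcal V]_\uparrow$; $C ::= [\cdot]\mid C\parallel M\mid M\parallel C$; $S ::= [\cdot]\mid S+\mathbf M\mid \mathbf M+S$. Reduction $\to$ (closed under the structural equations): base rules ($\beta_v$) $((\lambda x.M)\,V)[\mathcal U]_\lambda \to (M\langle x\mapsto V\rangle)[\mathcal U]_\downarrow$; variable rules: $x\langle\sigma\rangle\to x\{\sigma\}$; $\ast\langle\sigma\rangle\to\ast$; $((M\,N)[\mathcal V]_\lambda)\langle\sigma\rangle\to (M\langle\sigma\rangle\,N\langle\sigma\rangle)[\mathcal V\{\sigma\}]_\lambda$; $(\lambda y.M)\langle\sigma\rangle\to\lambda y.(M\langle\sigma\rangle)$; $\mathrm{get}(r)\langle\sigma\rangle\to\mathrm{get}(r)$; $(M\parallel M')\langle\sigma\rangle\to M\langle\sigma\rangle\parallel M'\langle\sigma\rangle$; $(M[\mathcal V]_\downarrow)\langle\sigma\rangle\to (M\langle\sigma\rangle)[\mathcal V\{\sigma\}]_\downarrow$; $(M[\mathcal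 V]_\uparrow)\langle\sigma\rangle\to (M\langle\sigma\rangle)[\mathcal V\{\sigma\}]_\uparrow$; $M\langle\sigma\rangle\langle\tau\rangle\to M\langle\sigma,\tau\rangle$; downward rules: $V[\mathcal V]_\downarrow\to V$; $(M\parallel M')[\mathcal V]_\downarrow\to M[\mathcal V]_\downarrow\parallel M'[\mathcal V]_\downarrow$; $(M[\mathcal U]_\uparrow)[\mathcal V]_\downarrow\to (M[\mathcal V]_\downarrow)[\mathcal U]_\uparrow$; $(M[\mathcal U]_\downarrow)[\mathcal V]_\downarrow\to M[\mathcal U,\mathcal V]_\downarrow$; $((M\,N)[\mathcal U]_\lambda)[\mathcal V]_\downarrow\to (M[\mathcal V]_\downarrow\,N[\mathcal V]_\downarrow)[\mathcal U,\mathcal V]_\lambda$; upward rules: $(M[\mathcal V]_\uparrow)\parallel N\to (M\parallel N[\mathcal V]_\downarrow)[\mathcal V]_\uparrow$; $((M[\mathcal V]_\uparrow)\,N)[\mathcal U]_\lambda\to ((M\,N[\mathcal V]_\downarrow)[\mathcal U,\mathcal V]_\lambda)[\mathcal V]_\uparrow$; $(M\,(N[\mathcal V]_\uparrow))[\mathcal U]_\lambda\to ((M[\mathcal V]_\downarrow\,N)[\mathcal U,\mathcal V]_\lambda)[\mathcal V]_\uparrow$. If $M\to M'$ by any base rule, then $S[C[E[M]]]\to S[C[E[M']]]$. Additionally: $S[C[E[\mathrm{get}(r)[\mathcal V]_\downarrow]]]\to S[C[E[\mathrm{get}(r)]]]+\sum_{V\in\mathcal V(r)}C[E[V]]$ (empty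 sum is $\mathbf 0$), and $S[M[\mathcal V]_\uparrow]\to S[M]$. Types: effects $e$ are finite sets of references; types $\alpha ::= \mathbf B\mid A$; value types $A ::= \mathrm{Unit}\mid A\xrightarrow{e}\alpha\mid \mathrm{Ref}_r A$. Reference contexts $R=r_1:A_1,\dots,r_n:A_n$ (ordered), variable contexts $\Gamma=x_1:A_1,\dots$. Well-formedness: $\emptyset\vdash$; if $R\vdash A$ and $r\notin\mathrm{dom}(R)$ then $R,r:A\vdash$; if $R\vdash$ then $R\vdash\mathrm{Unit}$ and $R\vdash\mathbf B$; if $R\vdash A$, $R\vdash\alpha$, $e\subseteq\mathrm{dom}(R)$ then $R\vdash A\xrightarrow{e}\alpha$; if $R\vdash$ and $r:A\in R$ then $R\vdash\mathrm{Ref}_rA$; $R\vdash\Gamma$ means all types of $\Gamma$ are well formed under $R$. Subtyping: $R\vdash\alpha\le\alpha$; if $R\vdash A'\le A$ and $R\vdash(\alpha,e)\le(\alpha',e')$ then $R\vdash A\xrightarrow{e}\alpha\le A'\xrightarrow{e'}\alpha'$; if $e\subseteq e'\subseteq\mathrm{dom}(R)$ and $R\vdash\alpha\le\alpha'$ then $R\vdash(\alpha,e)\le(\alpha',e')$. Typing rules for $R;\Gamma\vdash M:(\alpha,e)$: (var) if $R\vdash\Gamma,x:A$ then $R;\Gamma,x:A\vdash x:(A,\emptyset)$; (unit) if $R\vdash\Gamma$ then $R;\Gamma\vdash\ast:(\mathrm{Unit},\emptyset)$; (reg) if $R\vdash\Gamma$ and $r:A\in R$ then $R;\Gamma\vdash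 r:\mathrm{Ref}_rA$; (lam) from $R;\Gamma,x:A\vdash M:(\alpha,e)$ infer $R;\Gamma\vdash\lambda x.M:(A\xrightarrow{e}\alpha,\emptyset)$; (get) if $R;\Gamma\vdash r:\mathrm{Ref}_rA$ then $R;\Gamma\vdash\mathrm{get}(r):(A,\{r\})$; (sub) from $R;\Gamma\vdash M:(\alpha,e)$ and $R\vdash(\alpha,e)\le(\alpha',e')$ infer $R;\Gamma\vdash M:(\alpha',e')$; (subst) from $R;\Gamma,x_1:A_1,\dots,x_n:A_n\vdash M:(\alpha,e)$ and $R;\Gamma\vdash V_i:(A_i,\emptyset)$ for all $i$ infer $R;\Gamma\vdash M\langle x_1\mapsto V_1,\dots,x_n\mapsto V_n\rangle:(\alpha,e)$; (subst-r) for $\xi\in\{\uparrow,\downarrow,\lambda\}$ and $\mathcal V$ with domain $\{r_1,\dots,r_k\}$: from $R;\Gamma\vdash r_i:\mathrm{Ref}_{r_i}A_i$, $R;\Gamma\vdash M:(\alpha,e)$, $r_i\in e$, and $R;\Gamma\vdash V:(A_i,\emptyset)$ for every $V\in\mathcal V(r_i)$, infer $R;\Gamma\vdash M[\mathcal V]_\xi:(\alpha,e)$, where for $\xi=\lambda$ the term $M$ is an application $(M_1\,M_2)$ typed by the (app) rule: from $R;\Gamma\vdash M_1:(A\xrightarrow{e_1}\alpha,e_2)$ and $R;\Gamma\vdash M_2:(A,e_3)$ infer $(M_1\,M_2):(\alpha,e_1\cup e_2\cup e_3)$ (this (app) step is always combined with a (subst-r) step for $\xi=\lambda$); (par) from $R;\Gamma\vdash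 M_i:(\alpha_i,e_i)$, $i=1,2$, infer $R;\Gamma\vdash M_1\parallel M_2:(\mathbf B,e_1\cup e_2)$; (sum) from $R;\Gamma\vdash\mathbf M_i:(\alpha,e)$, $i=1,2$, infer $R;\Gamma\vdash\mathbf M_1+\mathbf M_2:(\alpha,e)$.
   Formalization: Idempotence of + may only erase duplicates: as a two-way equation every reducible M loops (M = M+M → M+M' = M+M+M' → M+M'). Also (σ,τ) applies τ to σ(x) for all x in dom(σ), since the literal definition is not α-invariant. *)

(* Defs.v *)
From Stdlib Require Import Relations Sorting.Permutation.
From Stdlib Require List.
From mathcomp Require Import all_boot finmap.

Set Implicit Arguments.
Unset Strict Implicit.
Unset Printing Implicit Defensive.

(** * Syntax *)

(* Variables are de Bruijn indices, so alpha-equivalence is equality.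
   [tsub M s] is M<sigma> where dom(sigma) has [size s] elements: in M the
   indices 0 .. size s - 1 are the variables of dom(sigma), with values
   [nth _ s i], and the index i >= size s is the outer variable i - size s.
   The values of [s] live outside of this binder. *)

Definition ref := nat.

Inductive value : Type :=
  | vvar of nat
  | vstar
  | vlam of term
with term : Type :=
  | tvalue of value
  | tsub of term & seq value
  | tapp of term & term & seq (ref * seq value)
  | tget of ref
  | tdown of term & seq (ref * seq value)
  | tup of term & seq (ref * seq value)
  | tpar of term & term.

(* A list of entries (r, vs) denotes the finite partial map whose domain is
   the set of the listed references and which sends r to the multiset union of
   all the entries for r; [rsub_ax] below identifies two lists that denote the
   same map.  Hence (U, V) is the concatenation [U ++ V]. *)
Definition rsub := seq (ref * seq value).

Definition rdom (U : rsub) : seq ref := [seq p.1 | p <- U].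

Definition rlookup (U : rsub) (r : ref) : seq value :=
  flatten [seq p.2 | p <- U & p.1 == r].

Inductive tsum : Type :=
  | szero
  | sone of term
  | splus of tsum & tsum.

(** * Renaming *)

Definition upn (n : nat) (xi : nat -> nat) (i : nat) : nat :=
  if i < n then i else n + xi (i - n).

Fixpoint ren_v (xi : nat -> nat) (V : value) {struct V} : value :=
  match V with
  | vvar i => vvar (xi i)
  | vstar => vstar
  | vlam M => vlam (ren_t (upn 1 xi) M)
  end
with ren_t (xi : nat -> nat) (M : term) {struct M} : term :=
  let ren_r := map (fun p : ref * seq value =>
                      let: (r, vs) := p in (r, map (ren_v xi) vs)) in
  match M with
  | tvalue V => tvalue (ren_v xi V)
  | tsub N s => tsub (ren_t (upn (size s) xi) N) (map (ren_v xi) s)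
  | tapp N P U => tapp (ren_t xi N) (ren_t xi P) (ren_r U)
  | tget r => tget r
  | tdown N U => tdown (ren_t xi N) (ren_r U)
  | tup N U => tup (ren_t xi N) (ren_r U)
  | tpar N P => tpar (ren_t xi N) (ren_t xi P)
  end.

(* Passing from lam y. (M in the scope of y, then sigma) to
   lam y. (M in the scope of sigma, then y): y moves from 0 to n. *)
Definition lam_shift (n i : nat) : nat :=
  if i == 0 then n else if i <= n then i.-1 else i.

Definition swap_idx (k i : nat) : nat :=
  if i == k then k.+1 else if i == k.+1 then k else i.

(** * The operations V{sigma}, U{sigma} and (sigma, tau) *)

Definition vsubst (s : seq value) (V : value) : value :=
  match V with
  | vvar i => nth (vvar (i - size s)) s i
  | vstar => vstar
  | vlam M => vlam (tsub (ren_t (lam_shift (size s)) M) (map (ren_v S) s))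
  end.

Definition rsubst (s : seq value) (U : rsub) : rsub :=
  [seq (p.1, map (vsubst s) p.2) | p <- U].

(* In M<sigma><tau>, dom(tau) binds in the values of sigma, and by
   alpha-conversion dom(sigma) and dom(tau) are disjoint: (sigma, tau) sends x
   to sigma(x){tau} on dom(sigma) and to tau(x) on dom(tau). *)
Definition scomp (s t : seq value) : seq value := map (vsubst t) s ++ t.

(** * Structural equations *)

(* One application of an equation, at any depth in a term.  Besides the associativity
   and commutativity of parallel composition, these are the equations saying
   that sigma is a finite map (the order of its entries is immaterial) and
   that a reference substitution is a finite map to multisets. *)
Inductive value_ax : value -> value -> Prop :=
  | vax_lam M M' : term_ax M M' -> value_ax (vlam M) (vlam M')
with rsub_ax : rsub -> rsub -> Prop :=
  | rax_entry U1 U2 a b :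
      rsub_ax (U1 ++ a :: b :: U2) (U1 ++ b :: a :: U2)
  | rax_merge U1 U2 r vs ws :
      rsub_ax (U1 ++ (r, vs) :: (r, ws) :: U2) (U1 ++ (r, vs ++ ws) :: U2)
  | rax_multiset U1 U2 r vs ws : Permutation vs ws ->
      rsub_ax (U1 ++ (r, vs) :: U2) (U1 ++ (r, ws) :: U2)
  | rax_value U1 U2 r vs ws V V' : value_ax V V' ->
      rsub_ax (U1 ++ (r, vs ++ V :: ws) :: U2) (U1 ++ (r, vs ++ V' :: ws) :: U2)
with term_ax : term -> term -> Prop :=
  | tax_parA M N P : term_ax (tpar M (tpar N P)) (tpar (tpar M N) P)
  | tax_parC M N : term_ax (tpar M N) (tpar N M)
  | tax_sub_entry M s1 s2 V W :
      term_ax (tsub M (s1 ++ V :: W :: s2))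
              (tsub (ren_t (swap_idx (size s1)) M) (s1 ++ W :: V :: s2))
  | tax_val V V' : value_ax V V' -> term_ax (tvalue V) (tvalue V')
  | tax_subl M M' s : term_ax M M' -> term_ax (tsub M s) (tsub M' s)
  | tax_subr M s1 s2 V V' : value_ax V V' ->
      term_ax (tsub M (s1 ++ V :: s2)) (tsub M (s1 ++ V' :: s2))
  | tax_appl M M' N U : term_ax M M' -> term_ax (tapp M N U) (tapp M' N U)
  | tax_appr M N N' U : term_ax N N' -> term_ax (tapp M N U) (tapp M N' U)
  | tax_appu M N U U' : rsub_ax U U' -> term_ax (tapp M N U) (tapp M N U')
  | tax_downl M M' U : term_ax M M' -> term_ax (tdown M U) (tdown M' U)
  | tax_downr M U U' : rsub_ax U U' -> term_ax (tdown M U) (tdown M U')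
  | tax_upl M M' U : term_ax M M' -> term_ax (tup M U) (tup M' U)
  | tax_upr M U U' : rsub_ax U U' -> term_ax (tup M U) (tup M U')
  | tax_parl M M' N : term_ax M M' -> term_ax (tpar M N) (tpar M' N)
  | tax_parr M N N' : term_ax N N' -> term_ax (tpar M N) (tpar M N').

Definition term_eq : term -> term -> Prop := clos_refl_sym_trans term term_ax.

(* All the equations on sums are used in both directions, except idempotence,
   which is used only to erase a duplicate.  Used to create duplicates, it
   would give M = M + M -> M + M' = M + M + M' -> M + M' + M' = M + M' as soon
   as M -> M', so that no reducible sum would be strongly normalizing. *)
Inductive sum_le : tsum -> tsum -> Prop :=
  | sle_refl M : sum_le M M
  | sle_trans M N P : sum_le M N -> sum_le N P -> sum_le M P
  | sle_plus M M' N N' :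
      sum_le M M' -> sum_le N N' -> sum_le (splus M N) (splus M' N')
  | sle_term M M' : term_eq M M' -> sum_le (sone M) (sone M')
  | sle_assoc M N P :
      sum_le (splus M (splus N P)) (splus (splus M N) P)
  | sle_assoc_sym M N P :
      sum_le (splus (splus M N) P) (splus M (splus N P))
  | sle_comm M N : sum_le (splus M N) (splus N M)
  | sle_zero M : sum_le (splus M szero) M
  | sle_zero_sym M : sum_le M (splus M szero)
  | sle_idem M : sum_le (splus M M) M.

(** * Contexts *)

Inductive ectx : Type :=
  | ehole
  | eappl of ectx & term & rsub
  | eappr of term & ectx & rsub
  | edown of ectx & rsub
  | eup of ectx & rsub.

Fixpoint efill (E : ectx) (M : term) : term :=
  match E with
  | ehole => M
  | eappl E' N U => tapp (efill E' M) N U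
  | eappr N E' U => tapp N (efill E' M) U
  | edown E' U => tdown (efill E' M) U
  | eup E' U => tup (efill E' M) U
  end.

Inductive cctx : Type :=
  | chole
  | cparl of cctx & term
  | cparr of term & cctx.

Fixpoint cfill (C : cctx) (M : term) : term :=
  match C with
  | chole => M
  | cparl C' N => tpar (cfill C' M) N
  | cparr N C' => tpar N (cfill C' M)
  end.

Inductive sctx : Type :=
  | shole
  | splusl of sctx & tsum
  | splusr of tsum & sctx.

Fixpoint sfill (S : sctx) (M : tsum) : tsum :=
  match S with
  | shole => M
  | splusl S' N => splus (sfill S' M) N
  | splusr N S' => splus N (sfill S' M)
  end.

(** * Reduction *)

Inductive base : term -> term -> Prop :=
  | b_beta M V U :
      base (tapp (tvalue (vlam M)) (tvalue V) U) (tdown (tsub M [:: V]) U)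
  (* the three rules for x<sigma>, *<sigma> and (lam y. M)<sigma> *)
  | b_sub_val V s : base (tsub (tvalue V) s) (tvalue (vsubst s V))
  | b_sub_app M N U s :
      base (tsub (tapp M N U) s) (tapp (tsub M s) (tsub N s) (rsubst s U))
  | b_sub_get r s : base (tsub (tget r) s) (tget r)
  | b_sub_par M N s : base (tsub (tpar M N) s) (tpar (tsub M s) (tsub N s))
  | b_sub_down M U s :
      base (tsub (tdown M U) s) (tdown (tsub M s) (rsubst s U))
  | b_sub_up M U s : base (tsub (tup M U) s) (tup (tsub M s) (rsubst s U))
  | b_sub_sub M s t : base (tsub (tsub M s) t) (tsub M (scomp s t))
  | b_down_val V U : base (tdown (tvalue V) U) (tvalue V)
  | b_down_par M N U : base (tdown (tpar M N) U) (tpar (tdown M U) (tdown N U))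
  | b_down_up M U V : base (tdown (tup M U) V) (tup (tdown M V) U)
  | b_down_down M U V : base (tdown (tdown M U) V) (tdown M (U ++ V))
  | b_down_app M N U V :
      base (tdown (tapp M N U) V) (tapp (tdown M V) (tdown N V) (U ++ V))
  | b_up_par M N V : base (tpar (tup M V) N) (tup (tpar M (tdown N V)) V)
  | b_up_appl M N U V :
      base (tapp (tup M V) N U) (tup (tapp M (tdown N V) (U ++ V)) V)
  | b_up_appr M N U V :
      base (tapp M (tup N V) U) (tup (tapp (tdown M V) N (U ++ V)) V).

Definition sum_of (Ms : seq term) : tsum :=
  foldr (fun M N => splus (sone M) N) szero Ms.

(* When r is not in dom(V), [rlookup V r] is empty and so is the sum. *)
Inductive red : tsum -> tsum -> Prop :=
  | red_base S C E M M' : base M M' ->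
      red (sfill S (sone (cfill C (efill E M))))
          (sfill S (sone (cfill C (efill E M'))))
  | red_get S C E r V :
      red (sfill S (sone (cfill C (efill E (tdown (tget r) V)))))
          (splus (sfill S (sone (cfill C (efill E (tget r)))))
                 (sum_of [seq cfill C (efill E (tvalue W)) | W <- rlookup V r]))
  | red_top S M V : red (sfill S (sone (tup M V))) (sfill S (sone M)).

Definition step (M N : tsum) : Prop :=
  exists M' N', [/\ sum_le M M', red M' N' & sum_le N' N].

(** * Types *)

Definition effect := {fset ref}.

Inductive vtype : Type :=
  | unitT
  | arrT of vtype & effect & type
  | refT of ref & vtype
with type : Type :=
  | behT
  | valT of vtype.

(* The most recent declaration comes first: R, r : A is (r, A) :: R. *)
Definition rctx := seq (ref * vtype).

Definition rctx_dom (R : rctx) : seq ref := [seq p.1 | p <- R].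

Inductive wf_rctx : rctx -> Prop :=
  | wf_nil : wf_rctx [::]
  | wf_cons R r A :
      wf_vtype R A -> r \notin rctx_dom R -> wf_rctx ((r, A) :: R)
with wf_vtype : rctx -> vtype -> Prop :=
  | wf_unit R : wf_rctx R -> wf_vtype R unitT
  | wf_arr R A e a :
      wf_vtype R A -> wf_type R a -> {subset e <= rctx_dom R} ->
      wf_vtype R (arrT A e a)
  | wf_ref R r A : wf_rctx R -> List.In (r, A) R -> wf_vtype R (refT r A)
with wf_type : rctx -> type -> Prop :=
  | wf_beh R : wf_rctx R -> wf_type R behT
  | wf_val R A : wf_vtype R A -> wf_type R (valT A).

Inductive subtype (R : rctx) : type -> type -> Prop :=
  | st_refl a : subtype R a a
  | st_arr A e a A' e' a' :
      subtype R (valT A') (valT A) -> subeff R a e a' e' ->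
      subtype R (valT (arrT A e a)) (valT (arrT A' e' a'))
with subeff (R : rctx) : type -> effect -> type -> effect -> Prop :=
  | se_intro a e a' e' :
      {subset e <= e'} -> {subset e' <= rctx_dom R} -> subtype R a a' ->
      subeff R a e a' e'.

(** * Typing *)

(* A variable context lists the types of the indices 0, 1, ... *)
Definition vctx := seq vtype.

Definition wf_vctx (R : rctx) (G : vctx) : Prop :=
  forall A, List.In A G -> wf_vtype R A.

Inductive ref_typed (R : rctx) (G : vctx) : ref -> vtype -> Prop :=
  | rt_reg r A : wf_vctx R G -> List.In (r, A) R -> ref_typed R G r (refT r A).

(* For a reference substitution with domain r_1, ..., r_k, the types A_i are
   given by a function As on references. *)
Inductive typed (R : rctx) : vctx -> term -> type -> effect -> Prop :=
  | ty_var G i A : wf_vctx R G -> onth G i = Some A ->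
      typed R G (tvalue (vvar i)) (valT A) fset0
  | ty_unit G : wf_vctx R G -> typed R G (tvalue vstar) (valT unitT) fset0
  | ty_lam G A M a e : typed R (A :: G) M a e ->
      typed R G (tvalue (vlam M)) (valT (arrT A e a)) fset0
  | ty_get G r A : ref_typed R G r (refT r A) ->
      typed R G (tget r) (valT A) [fset r]%fset
  | ty_sub G M a e a' e' : typed R G M a e -> subeff R a e a' e' ->
      typed R G M a' e'
  | ty_subst G As M s a e :
      typed R (As ++ G) M a e ->
      size As = size s ->
      (forall i V A, onth s i = Some V -> onth As i = Some A ->
         typed R G (tvalue V) (valT A) fset0) ->
      typed R G (tsub M s) a e
  | ty_down G M U (As : ref -> vtype) a e :
      (forall r, r \in rdom U -> ref_typed R G r (refT r (As r))) ->
      typed R G M a e ->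
      {subset rdom U <= e} ->
      (forall r V, r \in rdom U -> List.In V (rlookup U r) ->
         typed R G (tvalue V) (valT (As r)) fset0) ->
      typed R G (tdown M U) a e
  | ty_up G M U (As : ref -> vtype) a e :
      (forall r, r \in rdom U -> ref_typed R G r (refT r (As r))) ->
      typed R G M a e ->
      {subset rdom U <= e} ->
      (forall r V, r \in rdom U -> List.In V (rlookup U r) ->
         typed R G (tvalue V) (valT (As r)) fset0) ->
      typed R G (tup M U) a e
  (* (app) followed by (subst-r) *)
  | ty_app G M N U (As : ref -> vtype) A a e1 e2 e3 :
      (forall r, r \in rdom U -> ref_typed R G r (refT r (As r))) ->
      typed R G M (valT (arrT A e1 a)) e2 ->
      typed R G N (valT A) e3 ->
      {subset rdom U <= (e1 `|` e2 `|` e3)%fset} ->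
      (forall r V, r \in rdom U -> List.In V (rlookup U r) ->
         typed R G (tvalue V) (valT (As r)) fset0) ->
      typed R G (tapp M N U) a (e1 `|` e2 `|` e3)%fset
  | ty_par G M N a1 e1 a2 e2 :
      typed R G M a1 e1 -> typed R G N a2 e2 ->
      typed R G (tpar M N) behT (e1 `|` e2)%fset.

Inductive sum_typed (R : rctx) (G : vctx) : tsum -> type -> effect -> Prop :=
  | sty_one M a e : typed R G M a e -> sum_typed R G (sone M) a e
  | sty_plus M N a e :
      sum_typed R G M a e -> sum_typed R G N a e ->
      sum_typed R G (splus M N) a e.

(* Main.v *)
Require Import Defs.
From Stdlib Require Import Relations Sorting.Permutation.
From Stdlib Require List.
From mathcomp Require Import all_boot finmap zify.

Set Implicit Arguments.
Unset Strict Implicit.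
Unset Printing Implicit Defensive.

(* Forgetting the reference substitutions in active position and performing
   the variable substitutions maps a term to a call-by-value lambda-term in
   which [get r] may return any value.  Beta steps and successful reads become
   steps of the erased term; all the other steps leave it unchanged, and they
   terminate for a lexicographic measure that ignores types.  The erased terms
   terminate by reducibility: a reducible term performs only the reads allowed
   by its effect when all the reads return reducible values, and every value
   that it stores is reducible.  Reducibility of the values stored in r is
   defined by recursion on the reference context, because the type of r only
   mentions earlier references.  A sum is a multiset of terms, and each step
   replaces one of them by finitely many of its reducts. *)

(* [Ann t r v] is [t] together with a value [v] stored in [r].  The rules moving
   the three kinds of reference substitutions are not tracked under a lambda,
   so one constructor is enough for all of them. *)
Inductive tm : Type :=
  | Var of nat
  | Star
  | Lam of tm
  | App of tm & tm
  | Get of ref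
  | Par of tm & tm
  | Ann of tm & ref & tm.

(** * Renaming and substitution on erased terms *)

Definition store := seq (ref * tm).

Definition isval (t : tm) : bool :=
  match t with Var _ | Star | Lam _ => true | _ => false end.

Definition upr (xi : nat -> nat) (i : nat) : nat :=
  if i is j.+1 then (xi j).+1 else 0.

Fixpoint ren (xi : nat -> nat) (t : tm) : tm :=
  match t with
  | Var i => Var (xi i)
  | Star => Star
  | Lam b => Lam (ren (upr xi) b)
  | App t1 t2 => App (ren xi t1) (ren xi t2)
  | Get r => Get r
  | Par t1 t2 => Par (ren xi t1) (ren xi t2)
  | Ann t1 r v => Ann (ren xi t1) r (ren xi v)
  end.

Definition up (s : nat -> tm) (i : nat) : tm :=
  if i is j.+1 then ren S (s j) else Var 0.

Fixpoint subst (s : nat -> tm) (t : tm) : tm :=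
  match t with
  | Var i => s i
  | Star => Star
  | Lam b => Lam (subst (up s) b)
  | App t1 t2 => App (subst s t1) (subst s t2)
  | Get r => Get r
  | Par t1 t2 => Par (subst s t1) (subst s t2)
  | Ann t1 r v => Ann (subst s t1) r (subst s v)
  end.

Lemma ren_ext xi xi' t : xi =1 xi' -> ren xi t = ren xi' t.
Proof.
elim: t xi xi' => //=.
- by move=> i xi xi' ->.
- by move=> b IH xi xi' E; rewrite (IH _ (upr xi')) // => -[|i] //=; rewrite E.
- by move=> t1 IH1 t2 IH2 xi xi' E; rewrite (IH1 _ _ E) (IH2 _ _ E).
- by move=> t1 IH1 t2 IH2 xi xi' E; rewrite (IH1 _ _ E) (IH2 _ _ E).
- by move=> t1 IH1 r t2 IH2 xi xi' E; rewrite (IH1 _ _ E) (IH2 _ _ E).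
Qed.

Lemma subst_ext s s' t : s =1 s' -> subst s t = subst s' t.
Proof.
elim: t s s' => //=.
- by move=> b IH s s' E; rewrite (IH _ (up s')) // => -[|i] //=; rewrite E.
- by move=> t1 IH1 t2 IH2 s s' E; rewrite (IH1 _ _ E) (IH2 _ _ E).
- by move=> t1 IH1 t2 IH2 s s' E; rewrite (IH1 _ _ E) (IH2 _ _ E).
- by move=> t1 IH1 r t2 IH2 s s' E; rewrite (IH1 _ _ E) (IH2 _ _ E).
Qed.

Lemma subst_id s t : s =1 Var -> subst s t = t.
Proof.
elim: t s => //=.
- by move=> b IH s E; rewrite IH // => -[|i] //=; rewrite E.
- by move=> t1 IH1 t2 IH2 s E; rewrite IH1 ?IH2.
- by move=> t1 IH1 t2 IH2 s E; rewrite IH1 ?IH2.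
- by move=> t1 IH1 r t2 IH2 s E; rewrite IH1 ?IH2.
Qed.

Lemma ren_subst_var xi t : ren xi t = subst (Var \o xi) t.
Proof.
elim: t xi => //=.
- by move=> b IH xi; rewrite IH; congr Lam; apply: subst_ext => -[].
- by move=> t1 IH1 t2 IH2 xi; rewrite IH1 IH2.
- by move=> t1 IH1 t2 IH2 xi; rewrite IH1 IH2.
- by move=> t1 IH1 r t2 IH2 xi; rewrite IH1 IH2.
Qed.

Lemma subst_ren s xi t : subst s (ren xi t) = subst (s \o xi) t.
Proof.
elim: t s xi => //=.
- by move=> b IH s xi; rewrite IH; congr Lam; apply: subst_ext => -[].
- by move=> t1 IH1 t2 IH2 s xi; rewrite IH1 IH2.
- by move=> t1 IH1 t2 IH2 s xi; rewrite IH1 IH2.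
- by move=> t1 IH1 r t2 IH2 s xi; rewrite IH1 IH2.
Qed.

Lemma ren_ren xi xi' t : ren xi (ren xi' t) = ren (xi \o xi') t.
Proof. by rewrite ren_subst_var subst_ren (ren_subst_var (xi \o xi')). Qed.

Lemma ren_subst xi s t : ren xi (subst s t) = subst (ren xi \o s) t.
Proof.
elim: t s xi => //=.
- move=> b IH s xi; rewrite IH; congr Lam; apply: subst_ext => -[] //= i.
  by rewrite !ren_ren.
- by move=> t1 IH1 t2 IH2 s xi; rewrite IH1 IH2.
- by move=> t1 IH1 t2 IH2 s xi; rewrite IH1 IH2.
- by move=> t1 IH1 r t2 IH2 s xi; rewrite IH1 IH2.
Qed.

Lemma subst_subst s s' t : subst s (subst s' t) = subst (subst s \o s') t.
Proof.
elim: t s s' => //=.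
- move=> b IH s s'; rewrite IH; congr Lam; apply: subst_ext => -[] //= i.
  by rewrite subst_ren ren_subst.
- by move=> t1 IH1 t2 IH2 s s'; rewrite IH1 IH2.
- by move=> t1 IH1 t2 IH2 s s'; rewrite IH1 IH2.
- by move=> t1 IH1 r t2 IH2 s s'; rewrite IH1 IH2.
Qed.

(** The default value of [nth] does the renumbering: an index past the list denotes an outer
    variable. *)
Definition sseq (ts : seq tm) (i : nat) : tm := nth (Var (i - size ts)) ts i.

Definition annl (t : tm) (ws : store) : tm :=
  foldr (fun p u => Ann u p.1 p.2) t ws.

Definition smap (f : tm -> tm) (ws : store) : store :=
  [seq (p.1, f p.2) | p <- ws].

Lemma ren_annl xi t ws : ren xi (annl t ws) = annl (ren xi t) (smap (ren xi) ws).
Proof. by elim: ws => //= p ws ->. Qed.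

Lemma subst_annl s t ws :
  subst s (annl t ws) = annl (subst s t) (smap (subst s) ws).
Proof. by elim: ws => //= p ws ->. Qed.

Lemma annl_cat t ws ws' : annl t (ws ++ ws') = annl (annl t ws') ws.
Proof. by rewrite /annl foldr_cat. Qed.

(** [strip] and [annots] split a term into its computation and the values already stored. Both stop
    at [Lam]: annotations inside a body take effect only when a beta step exposes them. *)
Fixpoint strip (t : tm) : tm :=
  match t with
  | App t1 t2 => App (strip t1) (strip t2)
  | Par t1 t2 => Par (strip t1) (strip t2)
  | Ann t1 _ _ => strip t1
  | _ => t
  end.

Fixpoint annots (t : tm) : store :=
  match t with
  | App t1 t2 | Par t1 t2 => annots t1 ++ annots t2
  | Ann t1 r v => (r, v) :: annots t1
  | _ => [::]
  end.

Lemma strip_annl t ws : strip (annl t ws) = strip t.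
Proof. by elim: ws. Qed.

Lemma annots_annl t ws : annots (annl t ws) = ws ++ annots t.
Proof. by elim: ws => //= -[r v] ws ->. Qed.

Lemma strip_val t : isval t -> strip t = t.
Proof. by case: t. Qed.

Lemma annots_val t : isval t -> annots t = [::].
Proof. by case: t. Qed.

Lemma In_cat T (x : T) l l' :
  List.In x (l ++ l') <-> List.In x l \/ List.In x l'.
Proof. by elim: l => [|y l IH] /=; tauto. Qed.

Lemma In_map T T' (f : T -> T') y l :
  List.In y (map f l) <-> exists2 x, y = f x & List.In x l.
Proof.
elim: l => [|x l [IH1 IH2]] /=; first by split => // -[].
split=> [[<-|H]|[x' E [H|H]]]; first by exists x; auto.
- by case: (IH1 H) => x' -> Hx'; exists x'; auto.
- by left; rewrite E H.
- by right; apply: IH2; exists x'.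
Qed.

(** * Translation *)

Section TermInd.
Variables (PV : value -> Prop) (PT : term -> Prop).

Definition Forall_values (s : seq value) := forall V, List.In V s -> PV V.
Definition Forall_rsub (U : rsub) :=
  forall p, List.In p U -> Forall_values p.2.

Hypotheses
  (Hvar : forall i, PV (vvar i)) (Hstar : PV vstar)
  (Hlam : forall M, PT M -> PV (vlam M))
  (Hval : forall V, PV V -> PT (tvalue V))
  (Hsub : forall M s, PT M -> Forall_values s -> PT (tsub M s))
  (Happ : forall M N U, PT M -> PT N -> Forall_rsub U -> PT (tapp M N U))
  (Hget : forall r, PT (tget r))
  (Hdown : forall M U, PT M -> Forall_rsub U -> PT (tdown M U))
  (Hup : forall M U, PT M -> Forall_rsub U -> PT (tup M U))
  (Hpar : forall M N, PT M -> PT N -> PT (tpar M N)).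

Lemma Forall_values_cons V s :
  PV V -> Forall_values s -> Forall_values (V :: s).
Proof. by move=> HV Hs W /= [<-|/Hs]. Qed.

Lemma Forall_rsub_cons r s U :
  Forall_values s -> Forall_rsub U -> Forall_rsub ((r, s) :: U).
Proof. by move=> Hs HU p /= [<-|/HU]. Qed.

(** The local fixpoints [go] and [gor] carry the recursion into the values nested in lists, in a
    form that the guard condition accepts. *)
Fixpoint value_rect' (V : value) : PV V :=
  match V with
  | vvar i => Hvar i
  | vstar => Hstar
  | vlam M => Hlam (term_rect' M)
  end
with term_rect' (M : term) : PT M :=
  let fix go (s : seq value) : Forall_values s :=
    match s return Forall_values s with
    | [::] => fun V (F : False) => False_ind _ F
    | V :: s' => Forall_values_cons (value_rect' V) (go s')
    end in
  let fix gor (U : rsub) : Forall_rsub U :=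
    match U return Forall_rsub U with
    | [::] => fun p (F : False) => False_ind _ F
    | (r, s) :: U' => Forall_rsub_cons (go s) (gor U')
    end in
  match M with
  | tvalue V => Hval (value_rect' V)
  | tsub N s => Hsub (term_rect' N) (go s)
  | tapp N P U => Happ (term_rect' N) (term_rect' P) (gor U)
  | tget r => Hget r
  | tdown N U => Hdown (term_rect' N) (gor U)
  | tup N U => Hup (term_rect' N) (gor U)
  | tpar N P => Hpar (term_rect' N) (term_rect' P)
  end.

Lemma value_term_ind : (forall V, PV V) /\ (forall M, PT M).
Proof. by split; [exact: value_rect' | exact: term_rect']. Qed.

End TermInd.

Fixpoint erase_v (V : value) : tm :=
  match V with
  | vvar i => Var i
  | vstar => Star
  | vlam M => Lam (erase_t M)
  end
with erase_t (M : term) : tm :=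
  let erase_r U := flatten (map (fun p : ref * seq value =>
                      let: (r, vs) := p in
                      map (fun V => (r, erase_v V)) vs) U) in
  match M with
  | tvalue V => erase_v V
  | tsub N s => subst (sseq (map erase_v s)) (erase_t N)
  | tapp N P U => annl (App (erase_t N) (erase_t P)) (erase_r U)
  | tget r => Get r
  | tdown N U | tup N U => annl (erase_t N) (erase_r U)
  | tpar N P => Par (erase_t N) (erase_t P)
  end.

(** A global name for the local function of [erase_t]; the two are convertible, so the equations
    below hold by computation. *)
Definition erase_r (U : rsub) : store :=
  flatten (map (fun p : ref * seq value =>
              let: (r, vs) := p in map (fun V => (r, erase_v V)) vs) U).

Lemma erase_t_app M N U : erase_t (tapp M N U) = annl (App (erase_t M) (erase_t N)) (erase_r U).
Proof. by []. Qed.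
Lemma erase_t_down M U : erase_t (tdown M U) = annl (erase_t M) (erase_r U).
Proof. by []. Qed.
Lemma erase_t_up M U : erase_t (tup M U) = annl (erase_t M) (erase_r U).
Proof. by []. Qed.
Lemma erase_t_sub M s : erase_t (tsub M s) = subst (sseq (map erase_v s)) (erase_t M).
Proof. by []. Qed.

Lemma erase_r_cons r vs U :
  erase_r ((r, vs) :: U) = map (fun V => (r, erase_v V)) vs ++ erase_r U.
Proof. by []. Qed.

Lemma erase_r_cat U U' : erase_r (U ++ U') = erase_r U ++ erase_r U'.
Proof. by rewrite /erase_r map_cat flatten_cat. Qed.

Lemma isval_trv V : isval (erase_v V).
Proof. by case: V. Qed.

Lemma map_ext_in T T' (f g : T -> T') l :
  (forall x, List.In x l -> f x = g x) -> map f l = map g l.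
Proof.
elim: l => //= x l IH H; rewrite H; last by left.
by rewrite IH // => y Hy; apply: H; right.
Qed.

Lemma erase_r_map (f : value -> value) (g : tm -> tm) U :
  (forall p, List.In p U -> forall V, List.In V p.2 -> erase_v (f V) = g (erase_v V)) ->
  erase_r [seq (p.1, map f p.2) | p <- U] = smap g (erase_r U).
Proof.
elim: U => //= -[r vs] U IH H.
rewrite !erase_r_cons IH /=; last by move=> p Hp; apply: H; right.
rewrite /smap map_cat -!map_comp; congr (_ ++ _).
by apply: map_ext_in => V HV /=; rewrite (H (r, vs)) //=; left.
Qed.

Lemma map_pair_eta (f : value -> value) (U : rsub) :
  map (fun p : ref * seq value => let: (r, vs) := p in (r, map f vs)) U =
  [seq (p.1, map f p.2) | p <- U].
Proof. by apply: eq_map => -[]. Qed.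

Lemma sseq_lt ts i : i < size ts -> sseq ts i = nth Star ts i.
Proof. by move=> H; exact: set_nth_default. Qed.

Lemma sseq_ge ts i : size ts <= i -> sseq ts i = Var (i - size ts).
Proof. by move=> H; rewrite /sseq nth_default. Qed.

Lemma upr_upn xi : upn 1 xi =1 upr xi.
Proof. by case=> [|i] //; rewrite /upn /= subn1. Qed.

Lemma sseq_map_upn xi ts i :
  sseq (map (ren xi) ts) (upn (size ts) xi i) = ren xi (sseq ts i).
Proof.
rewrite /upn; case: ltnP => H.
  by rewrite !sseq_lt ?size_map // (nth_map Star).
rewrite !sseq_ge ?size_map //; last by lia.
by rewrite addKn.
Qed.

Lemma erase_t_ren_mut :
  (forall V xi, erase_v (ren_v xi V) = ren xi (erase_v V)) /\
  (forall M xi, erase_t (ren_t xi M) = ren xi (erase_t M)).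
Proof.
apply: value_term_ind => //=.
- by move=> M IH xi; rewrite IH; congr Lam; apply: ren_ext; exact: upr_upn.
- move=> M s IH Hs xi; rewrite IH subst_ren ren_subst -map_comp.
  apply: subst_ext => i /=; rewrite -sseq_map_upn size_map; congr sseq.
  by rewrite -map_comp; apply: map_ext_in => V HV /=; rewrite Hs.
- move=> M N U IHM IHN HU xi; rewrite ren_annl /= IHM IHN map_pair_eta.
  by rewrite -!/(erase_r _) (erase_r_map (g := ren xi)) // => p Hp V HV; rewrite (HU p).
- move=> M U IHM HU xi; rewrite ren_annl /= IHM map_pair_eta.
  by rewrite -!/(erase_r _) (erase_r_map (g := ren xi)) // => p Hp V HV; rewrite (HU p).
- move=> M U IHM HU xi; rewrite ren_annl /= IHM map_pair_eta.
  by rewrite -!/(erase_r _) (erase_r_map (g := ren xi)) // => p Hp V HV; rewrite (HU p).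
- by move=> M N IHM IHN xi; rewrite IHM IHN.
Qed.

Lemma erase_v_ren xi V : erase_v (ren_v xi V) = ren xi (erase_v V).
Proof. exact: erase_t_ren_mut.1. Qed.

Lemma erase_t_ren xi M : erase_t (ren_t xi M) = ren xi (erase_t M).
Proof. exact: erase_t_ren_mut.2. Qed.

Lemma erase_v_vsubst s V : erase_v (vsubst s V) = subst (sseq (map erase_v s)) (erase_v V).
Proof.
case: V => [i||M] //=.
  case: (ltnP i (size s)) => H.
    by rewrite sseq_lt ?size_map // (nth_map vstar) // (set_nth_default vstar).
  by rewrite sseq_ge ?size_map // nth_default.
(* [lam_shift] moves the bound variable to index [size s], just past the weakened values, where
   [sseq] gives [Var 0]; the composite is [up] of the substitution. *)
congr Lam; rewrite erase_t_ren subst_ren; apply: subst_ext => -[|i] /=.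
  by rewrite /lam_shift eqxx sseq_ge ?size_map // subnn.
rewrite /lam_shift /= -map_comp; case: ltnP => H /=.
  rewrite !sseq_lt ?size_map // !(nth_map vstar) //= erase_v_ren //.
by rewrite !sseq_ge ?size_map //= 1?ltnW // subSn.
Qed.

Lemma erase_r_rsubst s U : erase_r (rsubst s U) = smap (subst (sseq (map erase_v s))) (erase_r U).
Proof. by apply: erase_r_map => p _ V _; exact: erase_v_vsubst. Qed.

Lemma erase_t_scomp M s t :
  erase_t (tsub M (scomp s t)) = erase_t (tsub (tsub M s) t).
Proof.
rewrite !erase_t_sub subst_subst; apply: subst_ext => i /=.
rewrite /scomp map_cat -map_comp (eq_map (erase_v_vsubst t)).
rewrite map_comp.
set ts := map erase_v s; set us := map erase_v t.
case: (ltnP i (size ts)) => H.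
  rewrite (sseq_lt H) sseq_lt ?size_cat ?size_map ?ltn_addr //; last by rewrite -(size_map erase_v).
  by rewrite nth_cat size_map H (nth_map Star).
rewrite (sseq_ge H) /= /sseq nth_cat !size_cat !size_map.
rewrite size_map in H; rewrite ltnNge H /= subnDA.
by [].
Qed.

Lemma erase_t_swap M s1 s2 V W :
  erase_t (tsub (ren_t (swap_idx (size s1)) M) (s1 ++ W :: V :: s2)) =
  erase_t (tsub M (s1 ++ V :: W :: s2)).
Proof.
rewrite !erase_t_sub erase_t_ren subst_ren; apply: subst_ext => i /=.
rewrite !map_cat /= /swap_idx -(size_map erase_v s1).
set ts := map erase_v s1; set us := map erase_v s2.
case: eqP => [->|H1]; first by rewrite /sseq !nth_cat !ltnn !subnn ltnNge leqnSn /= subSnn.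
case: eqP => [->|H2]; first by rewrite /sseq !nth_cat !ltnn !subnn ltnNge leqnSn /= subSnn.
rewrite /sseq !size_cat !nth_cat /=; case: ltnP => // H3.
(* The index lies beyond both exchanged entries, so it skips the two of them in either order. *)
have -> : i - size ts = (i - (size ts).+2).+2 by lia.
by [].
Qed.

(** * Erased reduction and its bisimulation *)

(** The image of the structural equations under erasure; [e_swap] is what remains of the fact that
    the entries of a reference substitution are unordered. *)
Inductive eqv : tm -> tm -> Prop :=
  | e_refl t : eqv t t
  | e_sym t u : eqv t u -> eqv u t
  | e_trans t u v : eqv t u -> eqv u v -> eqv t v
  | e_lam t t' : eqv t t' -> eqv (Lam t) (Lam t')
  | e_app t t' u u' : eqv t t' -> eqv u u' -> eqv (App t u) (App t' u')
  | e_par t t' u u' : eqv t t' -> eqv u u' -> eqv (Par t u) (Par t' u')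
  | e_ann t t' r v v' : eqv t t' -> eqv v v' -> eqv (Ann t r v) (Ann t' r v')
  | e_parA t u v : eqv (Par t (Par u v)) (Par (Par t u) v)
  | e_parC t u : eqv (Par t u) (Par u t)
  | e_swap t r v r' v' :
      eqv (Ann (Ann t r v) r' v') (Ann (Ann t r' v') r v).

(** A label records the exchange with the environment: a read with the value received, or the values
    released by a beta step. *)
Inductive label : Type :=
  | lget of ref & tm
  | lbeta of store.

(** Runs stripped terms, so a contractum is stripped at once and its annotations go to the label.
    The value [w] returned by a read is unconstrained here; conditions on it are imposed through the
    label. *)
Inductive tstep : tm -> label -> tm -> Prop :=
  | s_beta b v : isval v ->
      tstep (App (Lam b) v) (lbeta (annots (subst (sseq [:: v]) b)))
            (strip (subst (sseq [:: v]) b))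
  | s_get r w : tstep (Get r) (lget r w) w
  | s_appl t u l t' : tstep t l t' -> tstep (App t u) l (App t' u)
  | s_appr t u l u' : tstep u l u' -> tstep (App t u) l (App t u')
  | s_parl t u l t' : tstep t l t' -> tstep (Par t u) l (Par t' u)
  | s_parr t u l u' : tstep u l u' -> tstep (Par t u) l (Par t u').

Lemma tstep_val t l t' : tstep t l t' -> isval t = false.
Proof. by case. Qed.

Lemma eqv_ren xi t t' : eqv t t' -> eqv (ren xi t) (ren xi t').
Proof.
move=> H; elim: H xi => /=; eauto using eqv.
Qed.

Lemma eqv_up s s' : (forall i, eqv (s i) (s' i)) -> forall i, eqv (up s i) (up s' i).
Proof. by move=> H [|i] /=; [exact: e_refl | exact: eqv_ren]. Qed.

Lemma eqv_substl s t t' : eqv t t' -> eqv (subst s t) (subst s t').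
Proof. by move=> H; elim: H s => /=; eauto using eqv. Qed.

Lemma eqv_substr s s' t :
  (forall i, eqv (s i) (s' i)) -> eqv (subst s t) (subst s' t).
Proof.
elim: t s s' => //=; eauto using eqv.
by move=> b IH s s' H; apply: e_lam; apply: IH; exact: eqv_up.
Qed.

Lemma eqv_subst s s' t t' :
  eqv t t' -> (forall i, eqv (s i) (s' i)) -> eqv (subst s t) (subst s' t').
Proof. by move=> H1 H2; apply: e_trans (eqv_substl s H1) (eqv_substr _ H2). Qed.

Lemma eqv_sseq1 v v' i : eqv v v' -> eqv (sseq [:: v] i) (sseq [:: v'] i).
Proof. by case: i => [|i] //= H; exact: e_refl. Qed.

Lemma eqv_strip t t' : eqv t t' -> eqv (strip t) (strip t').
Proof. by elim=> /=; eauto using eqv. Qed.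

(** Multiplicity and order are ignored because the stored values will be checked one by one. *)
Definition store_le (ws ws' : store) : Prop :=
  forall r w, List.In (r, w) ws -> exists2 w', List.In (r, w') ws' & eqv w w'.

Definition store_eqv (ws ws' : store) : Prop :=
  store_le ws ws' /\ store_le ws' ws.

Lemma store_le_refl ws : store_le ws ws.
Proof. by move=> r w H; exists w => //; exact: e_refl. Qed.

Lemma store_le_trans ws1 ws2 ws3 :
  store_le ws1 ws2 -> store_le ws2 ws3 -> store_le ws1 ws3.
Proof.
move=> H1 H2 r w /H1 [w' /H2 [w'' H3 H4] H5].
by exists w'' => //; apply: e_trans H5 H4.
Qed.

Lemma store_le_cat ws1 ws2 ws1' ws2' :
  store_le ws1 ws1' -> store_le ws2 ws2' ->
  store_le (ws1 ++ ws2) (ws1' ++ ws2').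
Proof.
move=> H1 H2 r w /In_cat [/H1|/H2] [w' H3 H4]; exists w' => //;
  by apply/In_cat; auto.
Qed.

Lemma store_le_cons r w w' ws ws' :
  eqv w w' -> store_le ws ws' -> store_le ((r, w) :: ws) ((r, w') :: ws').
Proof.
move=> H1 H2 r' v [[<- <-]|/H2 [v' H3 H4]]; first by exists w' => //; left.
by exists v' => //; right.
Qed.

Lemma store_le_incl ws ws' : List.incl ws ws' -> store_le ws ws'.
Proof. by move=> H r w /H ?; exists w => //; exact: e_refl. Qed.

Lemma store_eqv_incl ws ws' :
  List.incl ws ws' -> List.incl ws' ws -> store_eqv ws ws'.
Proof. by split; exact: store_le_incl. Qed.

Lemma eqv_annots t t' : eqv t t' -> store_eqv (annots t) (annots t').
Proof.
elim=> /=.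
- by move=> u; split; exact: store_le_refl.
- by move=> u v _ [].
- by move=> u v w _ [H1 H2] _ [H3 H4]; split; eauto using store_le_trans.
- by move=> u v _ _; split; exact: store_le_refl.
- by move=> ? ? ? ? _ [H1 H2] _ [H3 H4]; split; exact: store_le_cat.
- by move=> ? ? ? ? _ [H1 H2] _ [H3 H4]; split; exact: store_le_cat.
- move=> ? ? r v v' _ [H1 H2] Hv _; split; apply: store_le_cons => //.
  exact: e_sym.
- by move=> u v w; rewrite catA; split; exact: store_le_refl.
- by move=> u v; apply: store_eqv_incl => p /In_cat ?; apply/In_cat; tauto.
- by move=> *; apply: store_eqv_incl => p /= ; tauto.
Qed.

Lemma eqv_isval t t' : eqv t t' -> isval t = isval t'.
Proof. by elim=> //= u v w _ -> _ ->. Qed.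

(** The two directions are proved together because [eqv] has a symmetry constructor. *)
Lemma eqv_lam_inv t t' : eqv t t' ->
  (forall b, t = Lam b -> exists2 b', t' = Lam b' & eqv b b') /\
  (forall b, t' = Lam b -> exists2 b', t = Lam b' & eqv b b').
Proof.
elim=> //.
- by move=> u; split=> b ->; exists b => //; exact: e_refl.
- by move=> u v _ [].
- move=> u v w _ [H1 H2] _ [H3 H4]; split=> b.
    case/H1 => b' /H3 [b'' -> H5] H6; exists b'' => //; exact: e_trans H6 H5.
  case/H4 => b' /H2 [b'' -> H5] H6; exists b'' => //; exact: e_trans H6 H5.
- move=> u v H _; split=> b [<-]; first by exists v.
  by exists u => //; exact: e_sym.
Qed.

(** The value of a read is chosen by the environment, which can hand the same one to both sides;
    released stores can only be matched up to [eqv]. *)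
Definition label_eqv (l l' : label) : Prop :=
  match l, l' with
  | lget r w, lget r' w' => r = r' /\ w = w'
  | lbeta ws, lbeta ws' => store_eqv ws ws'
  | _, _ => False
  end.

Lemma label_eqv_refl l : label_eqv l l.
Proof. by case: l => //= ws; split; exact: store_le_refl. Qed.

Lemma label_eqv_trans l1 l2 l3 :
  label_eqv l1 l2 -> label_eqv l2 l3 -> label_eqv l1 l3.
Proof.
case: l1 l2 l3 => [r w|ws] [r' w'|ws'] [r'' w''|ws''] //=.
  by case=> -> -> [-> ->].
by case=> H1 H2 [H3 H4]; split; eauto using store_le_trans.
Qed.

Definition simulates (t t' : tm) : Prop :=
  forall l u, tstep t l u ->
  exists l' u', [/\ tstep t' l' u', label_eqv l l' & eqv u u'].

Lemma simulates_trans t t' t'' :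
  simulates t t' -> simulates t' t'' -> simulates t t''.
Proof.
move=> H1 H2 l u /H1 [l' [u' [/H2 [l'' [u'' [H3 H4 H5]]] H6 H7]]].
exists l'', u''; split=> //; [exact: label_eqv_trans H6 H4|exact: e_trans H7 H5].
Qed.

Lemma simulates_app t t' u u' :
  eqv t t' -> eqv u u' -> simulates t t' -> simulates u u' ->
  simulates (App t u) (App t' u').
Proof.
move=> Et Eu Ht Hu l x Hs; inversion Hs; subst.
- have [b' ? Eb] := (eqv_lam_inv Et).1 _ erefl; subst.
  have E := eqv_subst Eb (fun i => eqv_sseq1 i Eu).
  eexists _, _; split; first by apply: s_beta; rewrite -(eqv_isval Eu).
  - exact: eqv_annots.
  - exact: eqv_strip.
- have [l' [x' [K1 K2 K3]]] := Ht _ _ H3.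
  by exists l', (App x' u'); split=> //; [exact: s_appl | exact: e_app].
- have [l' [x' [K1 K2 K3]]] := Hu _ _ H3.
  by exists l', (App t' x'); split=> //; [exact: s_appr | exact: e_app].
Qed.

Lemma simulates_par t t' u u' :
  eqv t t' -> eqv u u' -> simulates t t' -> simulates u u' ->
  simulates (Par t u) (Par t' u').
Proof.
move=> Et Eu Ht Hu l x Hs; inversion Hs; subst.
- have [l' [x' [K1 K2 K3]]] := Ht _ _ H3.
  by exists l', (Par x' u'); split=> //; [exact: s_parl | exact: e_par].
- have [l' [x' [K1 K2 K3]]] := Hu _ _ H3.
  by exists l', (Par t' x'); split=> //; [exact: s_parr | exact: e_par].
Qed.

(** The equations for [Par] only move threads, so the same step is available at another position;
    equivalent bodies give equivalent contracta. Symmetry again forces both directions into one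
    induction. *)
Lemma eqv_simulates t t' : eqv t t' -> simulates t t' /\ simulates t' t.
Proof.
elim=> {t t'}.
- by move=> u; split=> l v H; exists l, v; split=> //;
    [exact: label_eqv_refl | exact: e_refl | exact: label_eqv_refl | exact: e_refl].
- by move=> u v _ [].
- by move=> u v w _ [H1 H2] _ [H3 H4]; split; eauto using simulates_trans.
- by move=> u v _ _; split=> l x H; inversion H.
- by move=> t t' u u' Et [? ?] Eu [? ?]; split; apply: simulates_app; eauto using eqv.
- by move=> t t' u u' Et [? ?] Eu [? ?]; split; apply: simulates_par; eauto using eqv.
- by move=> t t' r v v' _ _ _ _; split=> l x H; inversion H.
- move=> t u v; split=> l x H; inversion H; subst.
  + eexists _, _; split; [exact: s_parl (s_parl _ H4)|exact: label_eqv_refl|exact: e_parA].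
  + inversion H4; subst.
    * eexists _, _; split; [exact: s_parl (s_parr _ H5)|exact: label_eqv_refl|exact: e_parA].
    * eexists _, _; split; [exact: s_parr H5|exact: label_eqv_refl|exact: e_parA].
  + inversion H4; subst.
    * eexists _, _; split; [exact: s_parl H5|exact: label_eqv_refl|exact: e_sym (e_parA _ _ _)].
    * eexists _, _; split; [exact: s_parr (s_parl _ H5)|exact: label_eqv_refl|exact: e_sym (e_parA _ _ _)].
  + eexists _, _; split; [exact: s_parr (s_parr _ H4)|exact: label_eqv_refl|exact: e_sym (e_parA _ _ _)].
- suff H t u : simulates (Par t u) (Par u t) by move=> t u; split.
  move=> l x H; inversion H; subst.
    by eexists _, _; split; [exact: s_parr H4|exact: label_eqv_refl|exact: e_parC].
  by eexists _, _; split; [exact: s_parl H4|exact: label_eqv_refl|exact: e_parC].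
- by move=> t r v r' v'; split=> l x H; inversion H.
Qed.

(** * Reducibility *)

Definition goods (rho : ref -> tm -> Prop) (e : effect) (ws : store) : Prop :=
  forall r w, List.In (r, w) ws -> r \in e /\ rho r w.

Definition label_in (e : effect) (l : label) : Prop :=
  if l is lget r _ then r \in e else True.

Definition label_assume (rho : ref -> tm -> Prop) (l : label) : Prop :=
  if l is lget r w then rho r w else True.

Definition label_emits (l : label) : store :=
  if l is lbeta ws then ws else [::].

(* Rely-guarantee: [e] bounds the reads; as long as the values read satisfy
   [rho], so do the values stored, and the computation terminates. *)
Inductive computes (rho : ref -> tm -> Prop) (e : effect) (P : tm -> Prop) :
    tm -> Prop :=
  | computes_val v : isval v -> P v -> computes rho e P v
  | computes_step t :
      ~~ isval t ->
      (forall l u, tstep t l u -> label_in e l) ->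
      (forall l u, tstep t l u -> label_assume rho l ->
         goods rho e (label_emits l)) ->
      (forall l u, tstep t l u -> label_assume rho l -> computes rho e P u) ->
      computes rho e P t.

Lemma computes_intro rho e (P : tm -> Prop) t :
  (isval t -> P t) ->
  (forall l u, tstep t l u -> label_in e l) ->
  (forall l u, tstep t l u -> label_assume rho l ->
     goods rho e (label_emits l)) ->
  (forall l u, tstep t l u -> label_assume rho l -> computes rho e P u) ->
  computes rho e P t.
Proof.
move=> H1 H2 H3 H4; case Hv: (isval t); first exact: computes_val (H1 Hv).
by apply: computes_step => //; rewrite Hv.
Qed.

(** Fuses the two constructors into one case: a value has no steps, so the conditions on steps hold
    vacuously for it. *)
Lemma computes_elim rho e (P Q : tm -> Prop) :
  (forall t, (isval t -> P t) ->
     (forall l u, tstep t l u -> label_in e l) ->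
     (forall l u, tstep t l u -> label_assume rho l ->
        goods rho e (label_emits l)) ->
     (forall l u, tstep t l u -> label_assume rho l -> computes rho e P u) ->
     (forall l u, tstep t l u -> label_assume rho l -> Q u) -> Q t) ->
  forall t, computes rho e P t -> Q t.
Proof.
move=> H t; elim=> {t}[v Hv HP|t Hv H1 H2 H3 IH]; apply: H => //.
- by move=> l u /tstep_val; rewrite Hv.
- by move=> l u /tstep_val; rewrite Hv.
- by move=> l u /tstep_val; rewrite Hv.
- by move=> l u /tstep_val; rewrite Hv.
- by move=> H; rewrite H in Hv.
Qed.

Lemma computes_isval rho e P v : computes rho e P v -> isval v -> P v.
Proof. by case=> // t /negbTE ->. Qed.

(** A logical relation on values. At an arrow only abstractions are tested; the latent effect bounds
    the reads of the body and the references in which it stores. [rho] is a parameter because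
    [sem_ref] will in turn be built from [sem_v]. *)
Fixpoint sem_v (rho : ref -> tm -> Prop) (A : vtype) (v : tm) {struct A} : Prop :=
  match A with
  | unitT | refT _ _ => isval v
  | arrT A' e a =>
      isval v /\ forall b w, v = Lam b -> sem_v rho A' w ->
        goods rho e (annots (subst (sseq [:: w]) b)) /\
        computes rho e (sem_t rho a) (strip (subst (sseq [:: w]) b))
  end
with sem_t (rho : ref -> tm -> Prop) (a : type) (v : tm) {struct a} : Prop :=
  match a with
  | behT => True
  | valT A => sem_v rho A v
  end.

Scheme vtype_mut := Induction for vtype Sort Prop
  with type_mut := Induction for type Sort Prop.
Combined Scheme vtype_type_ind from vtype_mut, type_mut.

Fixpoint sem_ref (R : rctx) (r : ref) (w : tm) : Prop :=
  if R is (r', A) :: R' then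
    if r == r' then sem_v (sem_ref R') A w else sem_ref R' r w
  else False.

Lemma sem_v_isval rho A v : sem_v rho A v -> isval v.
Proof. by case: A => //= A e a []. Qed.

Lemma computes_mono rho e e' P P' t :
  {subset e <= e'} -> (forall v, P v -> P' v) ->
  computes rho e P t -> computes rho e' P' t.
Proof.
move=> He HP; elim/computes_elim=> {}t H1 H2 H3 _ IH; apply: computes_intro; eauto.
- by move=> [r w|ws] u /H2 //=; exact: He.
- by move=> l u /H3 H /H {}H r w /H [/He].
Qed.

Lemma goods_mono rho e e' ws :
  {subset e <= e'} -> goods rho e ws -> goods rho e' ws.
Proof. by move=> He H r w /H [/He]. Qed.

Lemma computes_get rho (e : effect) (P : tm -> Prop) r :
  r \in e -> (forall w, rho r w -> isval w /\ P w) -> computes rho e P (Get r).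
Proof.
move=> Hr H; apply: computes_intro; first by [].
- by move=> l u Hs; inversion Hs.
- by move=> l u Hs _; inversion Hs.
- by move=> l u Hs; inversion Hs; subst => /= /H [Hw HP]; exact: computes_val.
Qed.

Lemma goods_nil rho e : goods rho e [::].
Proof. by move=> r w []. Qed.

(** Nested induction on the termination of the function and of the argument, which may reduce in any
    interleaving. A beta step is covered by the relation at the arrow type. *)
Lemma computes_app rho A a (e1 e2 e3 : effect) t u :
  computes rho e2 (sem_v rho (arrT A e1 a)) t ->
  computes rho e3 (sem_v rho A) u ->
  computes rho (e1 `|` e2 `|` e3)%fset (sem_t rho a) (App t u).
Proof.
set e := (_ `|` _ `|` _)%fset.
have S1 : {subset e1 <= e} by move=> r H; rewrite !in_fsetU H.
have S2 : {subset e2 <= e} by move=> r H; rewrite !in_fsetU H orbT.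
have S3 : {subset e3 <= e} by move=> r H; rewrite !in_fsetU H orbT.
move=> Ht; elim/computes_elim: t / Ht u => t H1 H2 H3 H4 IHt u Hu.
elim/computes_elim: u / Hu => u K1 K2 K3 K4 IHu.
(* Reassembled from its components because [IHt] asks for the reducibility of the current
   argument. *)
have Hu : computes rho e3 (sem_v rho A) u by apply: computes_intro.
apply: computes_intro; first by [].
- move=> l x Hs; inversion Hs as [b v Hv| |? ? ? ? Hs'|? ? ? ? Hs'| |]; subst.
  + by [].
  + by have := H2 _ _ Hs'; case: (l) => //= r _; exact: S2.
  + by have := K2 _ _ Hs'; case: (l) => //= r _; exact: S3.
- move=> l x Hs; inversion Hs as [b v Hv| |? ? ? ? Hs'|? ? ? ? Hs'| |]; subst => Hl.
  + by apply: goods_mono S1 ((H1 isT).2 _ _ erefl (K1 Hv)).1.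
  + exact: goods_mono S2 (H3 _ _ Hs' Hl).
  + exact: goods_mono S3 (K3 _ _ Hs' Hl).
- move=> l x Hs; inversion Hs as [b v Hv| |? ? ? ? Hs'|? ? ? ? Hs'| |]; subst => Hl.
  + exact: computes_mono S1 (fun v H => H) ((H1 isT).2 _ _ erefl (K1 Hv)).2.
  + exact: IHt Hs' Hl _ Hu.
  + exact: IHu Hs' Hl.
Qed.

Lemma computes_par rho (e1 e2 : effect) P1 P2 t u :
  computes rho e1 P1 t -> computes rho e2 P2 u ->
  computes rho (e1 `|` e2)%fset (fun _ => True) (Par t u).
Proof.
set e := (_ `|` _)%fset.
have S1 : {subset e1 <= e} by move=> r H; rewrite !in_fsetU H.
have S2 : {subset e2 <= e} by move=> r H; rewrite !in_fsetU H orbT.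
move=> Ht; elim/computes_elim: t / Ht u => t H1 H2 H3 H4 IHt u Hu.
elim/computes_elim: u / Hu => u K1 K2 K3 K4 IHu.
have Hu : computes rho e2 P2 u by apply: computes_intro.
apply: computes_intro; first by [].
- move=> l x Hs; inversion Hs as [| | | |? ? ? ? Hs'|? ? ? ? Hs']; subst.
  + by have := H2 _ _ Hs'; case: (l) => //= r _; exact: S1.
  + by have := K2 _ _ Hs'; case: (l) => //= r _; exact: S2.
- move=> l x Hs; inversion Hs as [| | | |? ? ? ? Hs'|? ? ? ? Hs']; subst => Hl.
  + exact: goods_mono S1 (H3 _ _ Hs' Hl).
  + exact: goods_mono S2 (K3 _ _ Hs' Hl).
- move=> l x Hs; inversion Hs as [| | | |? ? ? ? Hs'|? ? ? ? Hs']; subst => Hl.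
  + exact: IHt Hs' Hl _ Hu.
  + exact: IHu Hs' Hl.
Qed.

(** * Invariance of reducibility under equivalence, change of store predicate and subtyping *)

Definition eqv_closed (P : tm -> Prop) : Prop :=
  forall v v', eqv v v' -> P v -> P v'.

Lemma goods_eqv rho e ws ws' :
  (forall r, eqv_closed (rho r)) -> store_le ws' ws ->
  goods rho e ws -> goods rho e ws'.
Proof.
move=> Hrho Hle H r w /Hle [w' /H [? ?] E]; split=> //.
exact: Hrho (e_sym E) _.
Qed.

(** By bisimulation: a step of the equivalent term is answered by a step of the original with the
    same read or an equivalent released store. *)
Lemma computes_eqv rho e P :
  (forall r, eqv_closed (rho r)) -> eqv_closed P ->
  eqv_closed (computes rho e P).
Proof.
move=> Hrho HP t t' E H; elim/computes_elim: t / H t' E => t H1 H2 H3 H4 IH t' E.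
have [S1 S2] := eqv_simulates E.
apply: computes_intro.
- by rewrite -(eqv_isval E) => /H1; exact: HP E.
- move=> l u /S2 [l' [u' [/H2 H Hl _]]].
  by case: l l' Hl H => [r w|ws] [r' w'|ws'] //= [-> _].
- move=> l u /S2 [l' [u' [/H3 H Hl _]]].
  case: l l' Hl H => [r w|ws] [r' w'|ws'] //= Hl.
  by move=> /(_ I) H _; exact: goods_eqv Hl.1 H.
- move=> l u /S2 [l' [u' [Hs Hl Eu]]] Ha; apply: IH Hs _ _ (e_sym Eu).
  by case: l l' Hl Ha => [r w|ws] [r' w'|ws'] //= [<- <-].
Qed.

Lemma sem_eqv rho : (forall r, eqv_closed (rho r)) ->
  (forall A, eqv_closed (sem_v rho A)) /\ (forall a, eqv_closed (sem_t rho a)).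
Proof.
move=> Hrho; apply: vtype_type_ind => //=.
- by move=> v v' E; rewrite (eqv_isval E).
- move=> A IHA e a IHa v v' E [Hv H]; split; first by rewrite -(eqv_isval E).
  move=> b' w /(eqv_lam_inv E).2 [b Hb Eb] Hw.
  have [H1 H2] := H _ _ Hb Hw.
  have E' := eqv_substl (sseq [:: w]) Eb.
  split; first exact: goods_eqv (eqv_annots E').1 H1.
  exact: (computes_eqv Hrho IHa (eqv_strip (e_sym E')) H2).
- by move=> _ _ _ v v' E; rewrite (eqv_isval E).
Qed.

Lemma sem_ref_eqv R r : eqv_closed (sem_ref R r).
Proof.
elim: R r => [|[r' A] R IH] r v v' E //=; case: (r == r'); last exact: IH E.
by have [H _] := sem_eqv IH; exact: H E.
Qed.

(** A computation reads and stores only at references of [e], so only the restriction of [rho] to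
    [e] matters. The bound on reads is what turns an assumption on [rho'] into one on [rho]. *)
Lemma computes_agree rho rho' e P P' t :
  (forall r, r \in e -> forall w, rho r w <-> rho' r w) ->
  (forall v, P v -> P' v) ->
  computes rho e P t -> computes rho' e P' t.
Proof.
move=> Hrho HP; elim/computes_elim=> {}t H1 H2 H3 _ IH.
have H l u : tstep t l u -> label_assume rho' l -> label_assume rho l.
  by move=> /H2; case: l => //= r w Hr /(Hrho _ Hr).
apply: computes_intro; eauto.
by move=> l u Hs /(H _ _ Hs) /(H3 _ _ Hs) G r w /G [Hr /(Hrho _ Hr)].
Qed.

Lemma goods_agree rho rho' e ws :
  (forall r, r \in e -> forall w, rho r w <-> rho' r w) ->
  goods rho e ws -> goods rho' e ws.
Proof. by move=> H G r w /G [Hr /(H _ Hr)]. Qed.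

Definition agree (R : rctx) (rho rho' : ref -> tm -> Prop) : Prop :=
  forall r, r \in rctx_dom R -> forall w, rho r w <-> rho' r w.

(** Well-formedness keeps every latent effect within the domain of [R], so [computes_agree] applies
    at each arrow. *)
Lemma sem_agree :
  (forall A R rho rho', agree R rho rho' -> wf_vtype R A ->
     forall v, sem_v rho A v <-> sem_v rho' A v) /\
  (forall a R rho rho', agree R rho rho' -> wf_type R a ->
     forall v, sem_t rho a v <-> sem_t rho' a v).
Proof.
apply: vtype_type_ind => //=.
- move=> A IHA e a IHa.
  (* [agree] is symmetric, so one implication suffices. *)
  suff H R rho rho' : agree R rho rho' -> wf_vtype R (arrT A e a) ->
      forall v, sem_v rho (arrT A e a) v -> sem_v rho' (arrT A e a) v.
    move=> R rho rho' Hag Hwf v; split; first exact: H Hag Hwf v.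
    by apply: H Hwf v => r /Hag E w; rewrite E.
  move=> Hag Hwf; inversion Hwf as [|? ? ? ? HA Ha He|]; subst.
  move=> v /= [Hv H]; split=> // b w Hb Hw.
  have [H1 H2] := H b w Hb ((IHA _ _ _ Hag HA w).2 Hw).
  have Hr r : r \in e -> forall w, rho r w <-> rho' r w by move=> /He; exact: Hag.
  split; first exact: goods_agree H1.
  exact: (computes_agree Hr (fun x => (IHa _ _ _ Hag Ha x).1) H2).
- by move=> A IHA R rho rho' Hag Hwf; apply: IHA Hag _; inversion Hwf.
Qed.

Lemma In_rctx_dom R r (A : vtype) : List.In (r, A) R -> r \in rctx_dom R.
Proof.
elim: R => //= -[r' A'] R IH [[-> _]|/IH H]; rewrite inE ?eqxx //=.
by rewrite -/(rctx_dom R) H orbT.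
Qed.

(** Undoes the truncation made by [sem_ref]: the type of [r] is well formed under the earlier
    declarations, so by [sem_agree] it has the same meaning under the whole context. The general
    [rho] lets the induction pass to the tail of [R]. *)
Lemma sem_ref_In R r A rho : wf_rctx R -> List.In (r, A) R ->
  agree R (sem_ref R) rho -> forall w, sem_ref R r w <-> sem_v rho A w.
Proof.
elim: R => //= -[r' A'] R IH Hwf; inversion Hwf as [|? ? ? HA Hr']; subst.
have HR : wf_rctx R.
  by elim: HA {IH Hwf Hr'}.
move=> Hin Hag w.
(* The head reference is fresh, so it cannot shadow a reference of the tail. *)
have Hag' : agree R (sem_ref R) rho.
  move=> r0 Hr0 w0; have := Hag r0 _ w0; rewrite /= inE -/(rctx_dom R) Hr0 orbT.
  move=> /(_ isT); case: eqP => [E|//]; by rewrite -E Hr0 in Hr'.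
case: Hin => [[? ?]|Hin]; first by subst r' A'; rewrite eqxx; exact: (sem_agree.1 _ _ _ _ Hag' HA).
case: eqP => [E|_]; first by rewrite -E (In_rctx_dom Hin) in Hr'.
exact: IH.
Qed.

Scheme subtype_mut := Induction for subtype Sort Prop
  with subeff_mut := Induction for subeff Sort Prop.

Lemma sem_subtype R rho a a' : subtype R a a' ->
  forall v, sem_t rho a v -> sem_t rho a' v.
Proof.
move=> H.
apply: (@subtype_mut R (fun a a' _ => forall v, sem_t rho a v -> sem_t rho a' v)
  (fun a e a' e' _ => {subset e <= e'} /\
     forall v, sem_t rho a v -> sem_t rho a' v) _ _ _ a a' H) => //= {a a' H}.
move=> A e a A' e' a' _ HA _ [He Ha] v [Hv H]; split=> // b w Hb /HA Hw.
have [H1 H2] := H b w Hb Hw.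
by split; [exact: goods_mono H1 | exact: computes_mono H2].
Qed.

(** * Environments and the fundamental lemma *)

Definition scat (ts : seq tm) (s : nat -> tm) (i : nat) : tm :=
  if i < size ts then nth Star ts i else s (i - size ts).

Lemma subst_sseq s ts t :
  subst s (subst (sseq ts) t) = subst (scat (map (subst s) ts) s) t.
Proof.
rewrite subst_subst; apply: subst_ext => i /=; rewrite /scat size_map.
case: ltnP => H; first by rewrite sseq_lt // (nth_map Star).
by rewrite sseq_ge.
Qed.

Lemma subst_sseq1_up s w t :
  subst (sseq [:: w]) (subst (up s) t) = subst (scat [:: w] s) t.
Proof.
rewrite subst_subst; apply: subst_ext => -[|i] //=.
by rewrite subst_ren /scat /= subn1; apply: subst_id => j /=; rewrite /sseq /= nth_nil subn1.
Qed.

Lemma In_trr U r w :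
  List.In (r, w) (erase_r U) <-> exists2 V, w = erase_v V & List.In V (rlookup U r).
Proof.
rewrite /rlookup; elim: U => [|[r' vs] U [IH1 IH2]]; first by split=> // -[].
rewrite erase_r_cons /=; split.
  case/In_cat => [/In_map [V [<- ->]] HV|/IH1 [V -> HV]]; exists V => //.
    by rewrite eqxx /=; apply/In_cat; left.
  by case: eqP => //= _; apply/In_cat; right.
case=> V Ew HV; apply/In_cat.
have : (r' = r /\ List.In V vs) \/ List.In V (flatten [seq p.2 | p <- U & p.1 == r]).
  by case: eqP HV => [-> /= /In_cat|_]; tauto.
case=> [[-> HV']|HV']; first by left; apply/In_map; exists V; rewrite ?Ew.
by right; apply: IH2; exists V.
Qed.

Lemma rlookup_rdom U r V : List.In V (rlookup U r) -> r \in rdom U.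
Proof.
rewrite /rlookup; elim: U => //= -[r' vs] U IH /=.
by rewrite inE eq_sym; case: eqP => //= _; exact: IH.
Qed.

(** Indices beyond [G] must be sent to values too, so that a syntactic value always remains one
    after substitution; [Var] still realizes the empty context. *)
Definition realizes (R : rctx) (G : vctx) (s : nat -> tm) : Prop :=
  (forall i, isval (s i)) /\
  (forall i A, onth G i = Some A -> sem_v (sem_ref R) A (s i)).

Definition reducible (R : rctx) (a : type) (e : effect) (t : tm) : Prop :=
  goods (sem_ref R) e (annots t) /\
  computes (sem_ref R) e (sem_t (sem_ref R) a) (strip t).

Lemma onth_cat T (s1 s2 : seq T) i :
  onth (s1 ++ s2) i = if i < size s1 then onth s1 i else onth s2 (i - size s1).
Proof. by elim: s1 i => [|x s1 IH] [|i] //=; rewrite IH. Qed.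

Lemma onth_nth T (x0 : T) s i : i < size s -> onth s i = Some (nth x0 s i).
Proof. by elim: s i => [|y s IH] [|i] //= /IH. Qed.

Lemma realizes_scat R G As ts s :
  size As = size ts ->
  (forall i t, onth ts i = Some t -> isval t) ->
  (forall i t A, onth ts i = Some t -> onth As i = Some A ->
     sem_v (sem_ref R) A t) ->
  realizes R G s -> realizes R (As ++ G) (scat ts s).
Proof.
move=> Hsz Hv Hts [Hs1 Hs2]; split=> [i|i A]; rewrite /scat.
  by case: ltnP => // /(onth_nth Star) /Hv.
rewrite onth_cat Hsz; case: ltnP => [/(onth_nth Star) H|_]; last exact: Hs2.
exact: Hts H.
Qed.

Lemma subst_isval s V : (forall i, isval (s i)) -> isval (subst s (erase_v V)).
Proof. by case: V => //=. Qed.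

Lemma reducible_value R s V A e : (forall i, isval (s i)) ->
  reducible R (valT A) e (subst s (erase_v V)) ->
  sem_v (sem_ref R) A (subst s (erase_v V)).
Proof.
move=> Hs [_ H]; have Hv := subst_isval V Hs.
by move: H; rewrite strip_val // => /computes_isval; apply.
Qed.

Lemma reducible_annl R a e t ws :
  goods (sem_ref R) e ws -> reducible R a e t -> reducible R a e (annl t ws).
Proof.
move=> Hws [H1 H2]; rewrite /reducible annots_annl strip_annl; split=> //.
by move=> r w /In_cat [/Hws|/H1].
Qed.

Lemma goods_trr R G s U (As : ref -> vtype) (e : effect) :
  wf_rctx R -> realizes R G s ->
  (forall r, r \in rdom U -> ref_typed R G r (refT r (As r))) ->
  {subset rdom U <= e} ->
  (forall r V, r \in rdom U -> List.In V (rlookup U r) ->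
     reducible R (valT (As r)) fset0 (subst s (erase_v V))) ->
  goods (sem_ref R) e (smap (subst s) (erase_r U)).
Proof.
move=> HR [Hs _] Href He HU r w /In_map [[r' w'] [-> ->] /In_trr [V -> HV]].
have Hr := rlookup_rdom HV; split; first exact: He.
have := Href _ Hr => H; inversion H as [? ? _ Hin]; subst.
(* [As r] is the type that [R] declares for [r], so reducibility at [As r] is membership in
   [sem_ref R r]. *)
apply/(sem_ref_In HR Hin (rho := sem_ref R)) => //.
exact: reducible_value (HU _ _ Hr HV).
Qed.

(** Induction on typing. Explicit substitutions and beta arguments are absorbed into the
    environment, reference substitutions contribute good stored values, and the remaining rules are
    closure properties of [computes]. *)
Lemma fundamental R G M a e : wf_rctx R -> typed R G M a e ->
  forall s, realizes R G s -> reducible R a e (subst s (erase_t M)).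
Proof.
move=> HR; elim=> {G M a e}.
- move=> G i A _ Hi s [Hs1 Hs2] /=; have Hv := Hs1 i.
  rewrite /reducible annots_val // strip_val //; split; first exact: goods_nil.
  by apply: computes_val => //; exact: Hs2.
- move=> G _ s _; split; first exact: goods_nil.
  exact: computes_val.
- move=> G A M a e _ IH s Hs; split; first exact: goods_nil.
  apply: computes_val => //=; split=> // b w [<-] Hw.
  (* The argument of the beta step becomes index 0 of the environment. *)
  rewrite subst_sseq1_up; apply: IH.
  apply: (@realizes_scat R G [:: A] [:: w]) => //; first by move=> [|[]] //= t [<-]; exact: sem_v_isval Hw.
  by move=> [|[]] //= t B [<-] [<-].
- move=> G r A Hr s _; split; first exact: goods_nil.
  inversion Hr as [? ? _ Hin]; subst.
  apply: computes_get => [|w]; first exact: fset11.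
  move/(sem_ref_In HR Hin (rho := sem_ref R)) => H.
  have {}H : sem_v (sem_ref R) A w by apply: H.
  by split=> //; exact: sem_v_isval H.
- move=> G M a e a' e' _ IH Hle s Hs.
  have [H1 H2] := IH s Hs; inversion Hle as [? ? ? ? He _ Ha]; subst.
  split; first exact: goods_mono H1.
  exact: computes_mono He (sem_subtype Ha) H2.
- move=> G As M ss a e _ IH Hsz _ IHs s Hs.
  rewrite erase_t_sub subst_sseq; apply: IH; rewrite -map_comp.
  have Hon i t : onth [seq (subst s \o erase_v) V | V <- ss] i = Some t ->
      exists2 V, t = subst s (erase_v V) & onth ss i = Some V.
    by elim: (ss) i => [|V ss' IHss] [|i] //=; [move=> [<-]; exists V | exact: IHss].
  apply: realizes_scat => //; first by rewrite size_map.
    by move=> i t /Hon [V -> _]; apply: subst_isval; case: Hs.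
  move=> i t A /Hon [V -> HV] HA; apply: (reducible_value (e := fset0)); first by case: Hs.
  exact: IHs HV HA s Hs.
- move=> G M U As a e Href _ IH He _ IHU s Hs.
  rewrite erase_t_down subst_annl; apply: reducible_annl; last exact: IH.
  by apply: (goods_trr HR Hs Href He) => r V Hr HV; exact: IHU Hr HV s Hs.
- move=> G M U As a e Href _ IH He _ IHU s Hs.
  rewrite erase_t_up subst_annl; apply: reducible_annl; last exact: IH.
  by apply: (goods_trr HR Hs Href He) => r V Hr HV; exact: IHU Hr HV s Hs.
- move=> G M N U As A a e1 e2 e3 Href _ IHM _ IHN He _ IHU s Hs.
  rewrite erase_t_app subst_annl; apply: reducible_annl.
    by apply: (goods_trr HR Hs Href He) => r V Hr HV; exact: IHU Hr HV s Hs.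
  have [H1 H2] := IHM s Hs; have [H3 H4] := IHN s Hs; split=> /=.
    by move=> r w /In_cat [/H1|/H3] [Hr Hw]; rewrite !in_fsetU Hr ?orbT.
  exact: computes_app H2 H4.
- move=> G M N a1 e1 a2 e2 _ IHM _ IHN s Hs.
  have [H1 H2] := IHM s Hs; have [H3 H4] := IHN s Hs; split=> /=.
    by move=> r w /In_cat [/H1|/H3] [Hr Hw]; rewrite !in_fsetU Hr ?orbT.
  exact: computes_par H2 H4.
Qed.

(** * Simulation *)

Fixpoint ups (M : term) : nat :=
  match M with
  | tvalue _ | tget _ => 0
  | tsub N _ | tdown N _ => ups N
  | tup N _ => (ups N).+1
  | tapp N P _ | tpar N P => ups N + ups P
  end.

Fixpoint leaves (M : term) : nat :=
  match M with
  | tvalue _ | tget _ => 1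
  | tsub N _ | tdown N _ | tup N _ => leaves N
  | tapp N P _ | tpar N P => leaves N + leaves P
  end.

(* The number of pairs of an upward substitution and a leaf outside of its
   scope: an upward rule extends the scope. *)
Fixpoint pairs (M : term) : nat :=
  match M with
  | tvalue _ | tget _ => 0
  | tsub N _ | tdown N _ | tup N _ => pairs N
  | tapp N P _ | tpar N P =>
      pairs N + pairs P + ups N * leaves P + ups P * leaves N
  end.

(** A polynomial interpretation. The constant 2 pays for the second copy of a downward substitution
    that is distributed over two subterms, the successor in [tup] for crossing an upward one. Stored
    values have no weight, so copying or merging them is free. *)
Fixpoint weight (M : term) : nat :=
  match M with
  | tvalue _ | tget _ => 1
  | tsub N _ => 3 * weight N
  | tdown N _ => (2 * weight N).+1
  | tup N _ => (weight N).+1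
  | tapp N P _ | tpar N P => weight N + weight P + 2
  end.

Lemma leaves_gt0 M : 0 < leaves M.
Proof. by elim: M => //= *; rewrite addn_gt0; apply/orP; left. Qed.

Lemma weight_gt0 M : 0 < weight M.
Proof. by elim: M => //= *; lia. Qed.

(** [ups] and [leaves] have to be preserved exactly because the [pairs] of an enclosing term depend
    on them; this makes the decrease stable under contexts. *)
Definition mdecr (M M' : term) : Prop :=
  [/\ ups M' = ups M, leaves M' = leaves M &
      pairs M' < pairs M \/ pairs M' = pairs M /\ weight M' < weight M].

(** Inclusion rather than equality of annotations: they are discarded at values and copied by
    distribution. *)
Definition admin (M M' : term) : Prop :=
  [/\ strip (erase_t M') = strip (erase_t M),
      List.incl (annots (erase_t M')) (annots (erase_t M)) & mdecr M M'].

(** New annotations can only come from the label, and a value read must already be stored; the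
    latter will discharge the assumption on reads. *)
Definition work (M M' : term) : Prop :=
  exists l, [/\ tstep (strip (erase_t M)) l (strip (erase_t M')),
     List.incl (annots (erase_t M')) (annots (erase_t M) ++ label_emits l) &
     if l is lget r w then List.In (r, w) (annots (erase_t M)) else True].

Lemma ctx_closed (Q : term -> term -> Prop) :
  (forall M M' N U, Q M M' -> Q (tapp M N U) (tapp M' N U)) ->
  (forall M N N' U, Q N N' -> Q (tapp M N U) (tapp M N' U)) ->
  (forall M M' U, Q M M' -> Q (tdown M U) (tdown M' U)) ->
  (forall M M' U, Q M M' -> Q (tup M U) (tup M' U)) ->
  (forall M M' N, Q M M' -> Q (tpar M N) (tpar M' N)) ->
  (forall M N N', Q N N' -> Q (tpar M N) (tpar M N')) ->
  forall C E M M', Q M M' -> Q (cfill C (efill E M)) (cfill C (efill E M')).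
Proof.
move=> H1 H2 H3 H4 H5 H6 C E M M' H.
by elim: C => [|C IH N|N C IH] /=; eauto; elim: E => /=; eauto.
Qed.

Lemma mdecr_ctx C E M M' :
  mdecr M M' -> mdecr (cfill C (efill E M)) (cfill C (efill E M')).
Proof.
by apply: ctx_closed => > [H1 H2 H3]; split; rewrite /= ?H1 ?H2 //; lia.
Qed.

Lemma admin_ctx C E M M' :
  admin M M' -> admin (cfill C (efill E M)) (cfill C (efill E M')).
Proof.
case=> H1 H2 H3.
suff [K1 K2] : strip (erase_t (cfill C (efill E M'))) = strip (erase_t (cfill C (efill E M))) /\
    List.incl (annots (erase_t (cfill C (efill E M')))) (annots (erase_t (cfill C (efill E M)))).
  by split=> //; exact: mdecr_ctx.
move: (conj H1 H2).
apply: (@ctx_closed (fun M M' => strip (erase_t M') = strip (erase_t M) /\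
  List.incl (annots (erase_t M')) (annots (erase_t M)))) => {H1 H2 H3} > [H1 H2];
  rewrite ?erase_t_app ?erase_t_down ?erase_t_up ?strip_annl ?annots_annl /= ?H1; split=> //;
  move=> p; have := H2 p; rewrite !In_cat; tauto.
Qed.

Lemma work_ctx C E M M' :
  work M M' -> work (cfill C (efill E M)) (cfill C (efill E M')).
Proof.
apply: ctx_closed => > [l [H1 H2 H3]]; exists l;
  rewrite ?erase_t_app ?erase_t_down ?erase_t_up /= ?strip_annl ?annots_annl /=;
  (split; [by eauto using tstep | | by case: (l) H3 => // r w H3; rewrite !In_cat; tauto]);
  move=> p; have := H2 p; rewrite !In_cat; tauto.
Qed.

(** Only beta is visible. Erasure already performs the variable substitutions, and the other rules
    merely move, copy or drop annotations. *)
Lemma base_admin M M' : base M M' -> admin M M' \/ work M M'.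
Proof.
case=> {M M'}.
- move=> M V U; right; exists (lbeta (annots (subst (sseq [:: erase_v V]) (erase_t M)))).
  rewrite erase_t_app erase_t_down erase_t_sub !strip_annl !annots_annl /= (strip_val (isval_trv V)).
  split=> //; first exact: s_beta (isval_trv V).
  by move=> p; rewrite !In_cat; tauto.
- move=> V s; left; rewrite /admin erase_t_sub /= erase_v_vsubst.
  by do !split=> //=; right.
- move=> M N U s; left; rewrite /admin erase_t_sub !erase_t_app erase_r_rsubst subst_annl.
  by do !split=> //=; right; split; lia.
- by move=> r s; left; do !split=> //=; right.
- by move=> M N s; left; do !split=> //=; right; split; lia.
- move=> M U s; left; rewrite /admin erase_t_sub !erase_t_down erase_r_rsubst subst_annl.
  by do !split=> //=; right; split; lia.
- move=> M U s; left; rewrite /admin erase_t_sub !erase_t_up erase_r_rsubst subst_annl.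
  by do !split=> //=; right; split; lia.
- move=> M s t; left; rewrite /admin erase_t_scomp.
  by do !split=> //=; have := weight_gt0 M; right; split; lia.
- move=> V U; left; rewrite /admin erase_t_down strip_annl annots_annl.
  split=> //; first by move=> p; rewrite In_cat; tauto.
  by do !split=> //=; right.
- move=> M N U; left; rewrite /admin /= -!/(erase_r _) !strip_annl !annots_annl /=; split=> //.
    by move=> p; rewrite !In_cat; tauto.
  by do !split=> //=; right; split; lia.
- move=> M U V; left; rewrite /admin /= -!/(erase_r _) !strip_annl !annots_annl /=; split=> //.
    by move=> p; rewrite !In_cat; tauto.
  by do !split=> //=; right; split; lia.
- move=> M U V; left; rewrite /admin /= -!/(erase_r _) erase_r_cat !strip_annl !annots_annl /=; split=> //.
    by move=> p; rewrite !In_cat; tauto.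
  by do !split=> //=; right; split; lia.
- move=> M N U V; left; rewrite /admin /= -!/(erase_r _) erase_r_cat !strip_annl !annots_annl /= !strip_annl !annots_annl; split=> //.
    by move=> p; rewrite !In_cat; tauto.
  by do !split=> //=; right; split; lia.
(* In each of the three upward rules the scope takes in the leaves of the other side, so [pairs]
   drops by their number, whatever [weight] does. *)
- move=> M N V; left; rewrite /admin /= -!/(erase_r _) !strip_annl !annots_annl /= !strip_annl !annots_annl; split=> //.
    by move=> p; rewrite !In_cat; tauto.
  by have := leaves_gt0 N; do !split=> //=; left; nia.
- move=> M N U V; left; rewrite /admin /= -!/(erase_r _) erase_r_cat !strip_annl !annots_annl /= !strip_annl !annots_annl; split=> //.
    by move=> p; rewrite !In_cat; tauto.
  by have := leaves_gt0 N; do !split=> //=; left; nia.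
- move=> M N U V; left; rewrite /admin /= -!/(erase_r _) erase_r_cat !strip_annl !annots_annl /= !strip_annl !annots_annl; split=> //.
    by move=> p; rewrite !In_cat; tauto.
  by have := leaves_gt0 M; do !split=> //=; [lia|left; nia].
Qed.

(** * Structural equations *)

Lemma Permutation_annl t ws ws' :
  Permutation ws ws' -> eqv (annl t ws) (annl t ws').
Proof.
elim=> /=.
- exact: e_refl.
- by move=> p l l' _ IH; apply: e_ann => //; exact: e_refl.
- by move=> p q l; exact: e_swap.
- by move=> l1 l2 l3 _ H1 _ H2; exact: e_trans H1 H2.
Qed.

Lemma eqv_annl t t' ws : eqv t t' -> eqv (annl t ws) (annl t' ws).
Proof.
by move=> H; elim: ws => //= p ws IH; apply: e_ann => //; exact: e_refl.
Qed.

Scheme value_ax_mut := Induction for value_ax Sort Prop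
  with rsub_ax_mut := Induction for rsub_ax Sort Prop
  with term_ax_mut := Induction for term_ax Sort Prop.
Combined Scheme ax_ind from value_ax_mut, rsub_ax_mut, term_ax_mut.

(* Stdlib states these for its own [app] and [map], which are only convertible
   to the ones of seq. *)
Lemma Permutation_cat T (a a' b b' : seq T) :
  Permutation a a' -> Permutation b b' -> Permutation (a ++ b) (a' ++ b').
Proof. exact: Permutation_app. Qed.

Lemma Permutation_catC T (a b : seq T) : Permutation (a ++ b) (b ++ a).
Proof. exact: Permutation_app_comm. Qed.

Lemma Permutation_map' T T' (f : T -> T') (a b : seq T) :
  Permutation a b -> Permutation (map f a) (map f b).
Proof. exact: Permutation_map. Qed.

(** Reference substitutions are compared through the annotations they put on an arbitrary [t], since
    [eqv] relates terms and not stores. *)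
Lemma ax_eqv :
  (forall V V', value_ax V V' -> eqv (erase_v V) (erase_v V')) /\
  (forall U U', rsub_ax U U' -> forall t, eqv (annl t (erase_r U)) (annl t (erase_r U'))) /\
  (forall M M', term_ax M M' -> eqv (erase_t M) (erase_t M')).
Proof.
apply: (ax_ind (P := fun V V' _ => eqv (erase_v V) (erase_v V'))
  (P0 := fun U U' _ => forall t, eqv (annl t (erase_r U)) (annl t (erase_r U')))
  (P1 := fun M M' _ => eqv (erase_t M) (erase_t M'))).
- by move=> M M' _ H; exact: e_lam.
- move=> U1 U2 [r vs] [r' ws] t; apply: Permutation_annl.
  rewrite !erase_r_cat !erase_r_cons !catA; apply: Permutation_cat => //.
  by rewrite -!catA; apply: Permutation_cat => //; exact: Permutation_catC.
- move=> U1 U2 r vs ws t; rewrite !erase_r_cat !erase_r_cons map_cat -!catA.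
  exact: e_refl.
- move=> U1 U2 r vs ws H t; apply: Permutation_annl.
  rewrite !erase_r_cat !erase_r_cons; apply: Permutation_cat => //.
  by apply: Permutation_cat => //; exact: Permutation_map'.
- move=> U1 U2 r vs ws V V' _ IH t.
  rewrite !erase_r_cat !erase_r_cons !map_cat /= !annl_cat.
  apply: eqv_annl; apply: eqv_annl => /=.
  by apply: e_ann => //; exact: e_refl.
- by move=> M N P; exact: e_parA.
- by move=> M N; exact: e_parC.
- by move=> M s1 s2 V W; rewrite erase_t_swap; exact: e_refl.
- by [].
- by move=> M M' s _ IH; exact: eqv_substl.
- move=> M s1 s2 V V' _ IH; rewrite !erase_t_sub; apply: eqv_substr => i.
  rewrite /sseq !map_cat !nth_cat !size_cat /=; case: ifP => _; first exact: e_refl.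
  rewrite !size_map; case: (i - size s1) => [|j] //=; exact: e_refl.
- by move=> M M' N U _ IH; apply: eqv_annl; apply: e_app => //; exact: e_refl.
- by move=> M N N' U _ IH; apply: eqv_annl; apply: e_app => //; exact: e_refl.
- by move=> M N U U' _ IH; exact: IH.
- by move=> M M' U _ IH; exact: eqv_annl.
- by move=> M U U' _ IH; exact: IH.
- by move=> M M' U _ IH; exact: eqv_annl.
- by move=> M U U' _ IH; exact: IH.
- by move=> M M' N _ IH; apply: e_par => //; exact: e_refl.
- by move=> M N N' _ IH; apply: e_par => //; exact: e_refl.
Qed.

Lemma term_eq_eqv M M' : term_eq M M' -> eqv (erase_t M) (erase_t M').
Proof.
elim=> [N N'|N|N N' _|N1 N2 N3 _ H1 _ H2].
- exact: ax_eqv.2.2.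
- exact: e_refl.
- exact: e_sym.
- exact: e_trans H1 H2.
Qed.

Lemma measures_ren xi M :
  [/\ ups (ren_t xi M) = ups M, leaves (ren_t xi M) = leaves M,
      pairs (ren_t xi M) = pairs M & weight (ren_t xi M) = weight M].
Proof.
elim: M xi => //=.
- by move=> M IH s xi; case: (IH (upn (size s) xi)) => -> -> -> ->.
- by move=> M IHM N IHN U xi; case: (IHM xi) => -> -> -> ->; case: (IHN xi) => -> -> -> ->.
- by move=> M IH U xi; case: (IH xi) => -> -> -> ->.
- by move=> M IH U xi; case: (IH xi) => -> -> -> ->.
- by move=> M IHM N IHN xi; case: (IHM xi) => -> -> -> ->; case: (IHN xi) => -> -> -> ->.
Qed.

Lemma term_ax_measures M M' : term_ax M M' ->
  [/\ ups M = ups M', leaves M = leaves M',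
      pairs M = pairs M' & weight M = weight M'].
Proof.
elim=> //=.
- by move=> N P Q; split; rewrite ?mulnDl ?mulnDr; lia.
- by move=> N P; split; lia.
- move=> N s1 s2 V W.
  by have [-> -> -> ->] := measures_ren (swap_idx (size s1)) N.
- by move=> N N' s _ [-> -> -> ->].
- by move=> N N' P U _ [-> -> -> ->].
- by move=> N P P' U _ [-> -> -> ->].
- by move=> N N' U _ [-> -> -> ->].
- by move=> N N' U _ [-> -> -> ->].
- by move=> N N' P _ [-> -> -> ->].
- by move=> N P P' _ [-> -> -> ->].
Qed.

Lemma term_eq_measures M M' : term_eq M M' ->
  ups M + pairs M = ups M' + pairs M' /\ weight M = weight M'.
Proof.
elim=> [N N' /term_ax_measures [-> _ -> ->]||N N' _ [-> ->]|N1 N2 N3 _ [-> ->] _] //.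
Qed.

(** * Threads *)

(** A read turns one summand into several; each possible outcome is a separate step here, the
    pending read included. *)
Inductive thread_step : term -> term -> Prop :=
  | ts_base C E M M' : base M M' ->
      thread_step (cfill C (efill E M)) (cfill C (efill E M'))
  | ts_get C E r V :
      thread_step (cfill C (efill E (tdown (tget r) V)))
                  (cfill C (efill E (tget r)))
  | ts_read C E r V W : List.In W (rlookup V r) ->
      thread_step (cfill C (efill E (tdown (tget r) V)))
                  (cfill C (efill E (tvalue W)))
  | ts_top M V : thread_step (tup M V) M.

Definition thread_red (M N : term) : Prop :=
  exists2 M0, term_eq M M0 & thread_step M0 N.

(** Adding [ups] to [pairs] accounts for [ts_top]: it removes an upward substitution at the root,
    which lowers [ups] and leaves [pairs] unchanged. *)
Lemma thread_step_work M N : thread_step M N ->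
  work M N \/
  [/\ strip (erase_t N) = strip (erase_t M),
      List.incl (annots (erase_t N)) (annots (erase_t M)) &
      ups N + pairs N < ups M + pairs M \/
      ups N + pairs N = ups M + pairs M /\ weight N < weight M].
Proof.
have adm M' N' : admin M' N' -> [/\ strip (erase_t N') = strip (erase_t M'),
      List.incl (annots (erase_t N')) (annots (erase_t M')) &
      ups N' + pairs N' < ups M' + pairs M' \/
      ups N' + pairs N' = ups M' + pairs M' /\ weight N' < weight M'].
  by case=> -> H [-> _ H']; split=> //; lia.
case=> {M N}.
- move=> C E M M' /base_admin [/admin_ctx H|/work_ctx H]; last by left.
  by right; apply: adm.
- move=> C E r V; right; apply: adm; apply: admin_ctx.
  by rewrite /admin erase_t_down strip_annl annots_annl; do !split=> //=; right.
- move=> C E r V W HW; left; apply: work_ctx; exists (lget r (erase_v W)).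
  have Hv := isval_trv W.
  rewrite erase_t_down strip_annl annots_annl /= (strip_val Hv) (annots_val Hv); split=> //.
  + exact: s_get.
  + by apply/In_cat; left; apply/In_trr; exists W.
- move=> M V; right; rewrite erase_t_up strip_annl annots_annl; split=> //=; last by lia.
  by move=> p; rewrite In_cat; tauto.
Qed.

(** Lexicographic induction on [computes], then [ups + pairs], then [weight]. The invariant that all
    stored values are good is what makes every read satisfy the assumption of [computes]. *)
Lemma thread_acc rho e t : (forall r, eqv_closed (rho r)) ->
  computes rho e (fun _ => True) t ->
  forall M, eqv t (strip (erase_t M)) -> goods rho e (annots (erase_t M)) ->
  Acc (fun N M => thread_red M N) M.
Proof.
move=> Hrho; elim/computes_elim: t / => t _ _ Hgood _ IH M.
have [n] := ubnP (ups M + pairs M); elim: n M => [M|n IHn M Hn]; first by rewrite ltn0.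
have [m] := ubnP (weight M); elim: m M Hn => [M _|m IHm M Hn Hm Ht HM]; first by rewrite ltn0.
constructor=> N [M0 Heq Hstep].
have Eq := term_eq_eqv Heq; have [En Ew] := term_eq_measures Heq.
have Ht0 := e_trans Ht (eqv_strip Eq).
have HM0 : goods rho e (annots (erase_t M0)) := goods_eqv Hrho (eqv_annots Eq).2 HM.
case: (thread_step_work Hstep) => [[l [Hl Hincl Hget]]|[Es Hincl Hlt]]; last first.
  have HN : goods rho e (annots (erase_t N)) by move=> r w /Hincl; exact: HM0.
  rewrite -Es in Ht0; case: Hlt => [Hlt|[E Hlt]].
    by apply: IHn Ht0 HN; lia.
  by apply: IHm Ht0 HN; lia.
(* The visible step starts from the representative [M0]; bisimulation transports it to [t], where
   the outer induction hypothesis applies. *)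
have [l' [u [Hu Hl' Eu]]] := (eqv_simulates Ht0).2 _ _ Hl.
have Ha : label_assume rho l'.
  by case: l l' Hl' Hget {Hl Hu Hincl} => [r w|ws] [r' w'|ws'] //= [<- <-] /HM0 [].
apply: (IH _ _ Hu Ha) (e_sym Eu) _ => r w /Hincl /In_cat [/HM0 //|].
have := Hgood _ _ Hu Ha.
by case: l l' Hl' {Hl Hu Hincl Hget Ha} => [r' w'|ws] [r'' w''|ws'] //= [Hs _] /(goods_eqv Hrho Hs); apply.
Qed.

(** * Sums *)

Fixpoint threads (M : tsum) : seq term :=
  match M with
  | szero => [::]
  | sone N => [:: N]
  | splus N P => threads N ++ threads P
  end.

(* [sum_le] on the lists of terms: erasure comes from idempotence. *)
Inductive embeds : seq term -> seq term -> Prop :=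
  | emb_nil l : embeds l [::]
  | emb_cons l1 l2 M N k : term_eq M N -> embeds (l1 ++ l2) k ->
      embeds (l1 ++ M :: l2) (N :: k).

Lemma term_eq_refl M : term_eq M M.
Proof. exact: rst_refl. Qed.

Lemma embeds_refl l : embeds l l.
Proof.
elim: l => [|M l IH]; first exact: emb_nil.
exact: (emb_cons (l1 := [::]) (term_eq_refl M)).
Qed.

Lemma cat_cons_split T (a b c d : seq T) x y :
  a ++ x :: b = c ++ y :: d ->
  [\/ [/\ a = c, x = y & b = d],
      exists2 m, c = a ++ x :: m & b = m ++ y :: d |
      exists2 m, a = c ++ y :: m & d = m ++ x :: b].
Proof.
elim: a c => [|z a IH] [|z' c] //=.
- by case=> -> ->; constructor 1.
- by case=> -> ->; constructor 2; exists c.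
- by case=> -> <-; constructor 3; exists a.
- case=> -> /IH [[-> -> ->]|[m -> ->]|[m -> ->]].
  + by constructor 1.
  + by constructor 2; exists m.
  + by constructor 3; exists m.
Qed.

Lemma embeds_mid_inv l1 M l2 k : embeds (l1 ++ M :: l2) k ->
  embeds (l1 ++ l2) k \/
  exists k1 N k2, [/\ k = k1 ++ N :: k2, term_eq M N & embeds (l1 ++ l2) (k1 ++ k2)].
Proof.
move E: (l1 ++ M :: l2) => l H; elim: H l1 l2 E => {l k} [l|l1' l2' M' N k Heq Hk IH] l1 l2 E.
  by left; exact: emb_nil.
case: (cat_cons_split E) => [[-> -> ->]|[m E1 E2]|[m E1 E2]].
- by right; exists [::], N, k.
- subst; rewrite -catA cat_cons in IH.
  case: (IH l1 (m ++ l2') erefl) => [H|[k1 [P [k2 [-> HP H]]]]].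
    by left; rewrite catA; apply: emb_cons => //; rewrite -catA.
  right; exists (N :: k1), P, k2; split=> //.
  by rewrite catA; apply: emb_cons => //; rewrite -catA.
- subst; rewrite catA in IH.
  case: (IH (l1' ++ m) l2 erefl) => [H|[k1 [P [k2 [-> HP H]]]]].
    by left; rewrite -catA cat_cons; apply: emb_cons => //; rewrite catA.
  right; exists (N :: k1), P, k2; split=> //.
  by rewrite -catA cat_cons; apply: emb_cons => //; rewrite catA.
Qed.

Lemma cat_eq_cons_split T (a b c d : seq T) x :
  a ++ b = c ++ x :: d ->
  (exists2 m, a = c ++ x :: m & d = m ++ b) \/
  (exists2 m, b = m ++ x :: d & c = a ++ m).
Proof.
elim: a c => [|y a IH] [|z c] /=.
- by move=> ->; right; exists [::].
- by move=> ->; right; exists (z :: c).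
- by case=> -> <-; left; exists a.
- by case=> -> /IH [[m -> ->]|[m -> ->]]; [left|right]; exists m.
Qed.

Lemma embeds_weaken l1 M l2 k : embeds (l1 ++ l2) k -> embeds (l1 ++ M :: l2) k.
Proof.
move E: (l1 ++ l2) => l H.
elim: H l1 l2 E => {l k} [l|a b N P k Heq _ IH] l1 l2 E; first exact: emb_nil.
case: (cat_eq_cons_split E) => [[m -> E']|[m -> E']].
  rewrite -catA cat_cons; apply: emb_cons => //; rewrite catA.
  by apply: IH; rewrite -catA -E'.
rewrite -cat_cons catA; apply: emb_cons => //; rewrite -catA cat_cons.
by apply: IH; rewrite catA -E'.
Qed.

Lemma embeds_inv l k1 N k2 : embeds l (k1 ++ N :: k2) ->
  exists l1 M l2, [/\ l = l1 ++ M :: l2, term_eq M N & embeds (l1 ++ l2) (k1 ++ k2)].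
Proof.
elim: k1 l => [|P k1 IH] l H.
  by inversion H as [|l1 l2 M N' k' Heq Hk]; subst; exists l1, M, l2.
inversion H as [|l1 l2 M N' k' Heq Hk]; subst.
have [a [Q [b [E HQ Hab]]]] := IH _ Hk.
case: (cat_eq_cons_split E) => [[m E1 E2]|[m E1 E2]]; subst.
  exists a, Q, (m ++ M :: l2); split=> //; first by rewrite -catA.
  by rewrite catA; apply: emb_cons => //; rewrite -catA.
exists (l1 ++ M :: m), Q, b; split=> //; first by rewrite -catA.
by rewrite -catA cat_cons; apply: emb_cons => //; rewrite catA.
Qed.

Lemma embeds_trans l k m : embeds l k -> embeds k m -> embeds l m.
Proof.
move=> H Hm; elim: Hm l H => {k m} [k|k1 k2 M N m Heq _ IH] l H; first exact: emb_nil.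
have [l1 [P [l2 [-> HP /IH Hl]]]] := embeds_inv H.
by apply: emb_cons => //; exact: rst_trans HP Heq.
Qed.

Lemma embeds_cat l l' k k' : embeds l k -> embeds l' k' -> embeds (l ++ l') (k ++ k').
Proof.
move=> H H'; elim: H => {l k} [l|l1 l2 M N k Heq _ IH].
  by elim: l => //= M l IH; exact: (@embeds_weaken [::]).
by rewrite -catA cat_cons; apply: emb_cons => //; rewrite catA.
Qed.

Lemma embeds_catC l l' : embeds (l ++ l') (l' ++ l).
Proof.
elim: l' => [|M l' IH] /=; first by rewrite cats0; exact: embeds_refl.
exact: emb_cons (term_eq_refl M) IH.
Qed.

Lemma embeds_insert P l1 l2 : embeds (P :: l1 ++ l2) (l1 ++ P :: l2).
Proof.
elim: l1 => [|M l1 IH] /=; first exact: embeds_refl.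
exact: (@emb_cons [:: P]) (term_eq_refl M) IH.
Qed.

Lemma sum_le_embeds M N : sum_le M N -> embeds (threads M) (threads N).
Proof.
elim=> /=.
- by move=> P; exact: embeds_refl.
- by move=> P Q S _ H1 _ H2; exact: embeds_trans H1 H2.
- by move=> P P' Q Q' _ H1 _ H2; exact: embeds_cat.
- by move=> P P' H; apply: (@emb_cons [::] [::]) H (emb_nil _).
- by move=> P Q S; rewrite catA; exact: embeds_refl.
- by move=> P Q S; rewrite catA; exact: embeds_refl.
- by move=> P Q; exact: embeds_catC.
- by move=> P; rewrite cats0; exact: embeds_refl.
- by move=> P; rewrite cats0; exact: embeds_refl.
(* Idempotence keeps the first copy and erases the second. *)
- move=> P; rewrite -{3}[threads P]cats0.
  by apply: embeds_cat; [exact: embeds_refl | exact: emb_nil].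
Qed.

Lemma threads_sfill S :
  exists l1 l2, forall N, threads (sfill S N) = l1 ++ threads N ++ l2.
Proof.
elim: S => [|S [l1 [l2 IH]] P|P S [l1 [l2 IH]]] /=.
- by exists [::], [::] => N; rewrite cats0.
- by exists l1, (l2 ++ threads P) => N; rewrite IH !catA.
- by exists (threads P ++ l1), l2 => N; rewrite IH !catA.
Qed.

Lemma threads_sum_of Ms : threads (sum_of Ms) = Ms.
Proof. by elim: Ms => //= M Ms ->. Qed.

(* The step of the multiset extension of [thread_red], up to [embeds]. *)
Definition list_red (l l' : seq term) : Prop :=
  exists M Ns k, [/\ embeds l (M :: k),
     forall N, List.In N Ns -> thread_step M N & embeds (Ns ++ k) l'].

Lemma red_list_red M N : red M N -> list_red (threads M) (threads N).
Proof.
have key S P Ns Q : (forall N', List.In N' Ns -> thread_step P N') ->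
    (forall l1 l2, (forall N', threads (sfill S N') = l1 ++ threads N' ++ l2) ->
       embeds (Ns ++ l1 ++ l2) (threads Q)) ->
    list_red (threads (sfill S (sone P))) (threads Q).
  have [l1 [l2 E]] := threads_sfill S.
  move=> H1 H2; exists P, Ns, (l1 ++ l2); split=> //; last exact: H2.
  by rewrite E /=; apply: emb_cons (term_eq_refl P) (embeds_refl _).
case=> {M N}.
- move=> S C E M M' HM; apply: (key _ _ [:: cfill C (efill E M')]).
    by move=> N [<-|//]; exact: ts_base.
  by move=> l1 l2 ->; exact: embeds_insert.
- move=> S C E r V.
  apply: (key _ _ (cfill C (efill E (tget r)) ::
    [seq cfill C (efill E (tvalue W)) | W <- rlookup V r])).
    by move=> N [<-|/In_map [W -> HW]]; [exact: ts_get | exact: ts_read].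
  move=> l1 l2 E' /=; rewrite E' threads_sum_of /= -catA cat_cons.
  set ws := map _ _; set P := cfill _ _.
  (* The values read are appended at the end of the whole sum while the pending read stays in its
     place, so all the reducts are first moved behind [l1 ++ l2]. *)
  apply: (@embeds_trans _ ((l1 ++ l2) ++ P :: ws)); first exact: (@embeds_catC (P :: ws)).
  rewrite -catA; apply: embeds_cat (embeds_refl _) _.
  exact: emb_cons (term_eq_refl P) (embeds_refl _).
- move=> S M V; apply: (key _ _ [:: M]).
    by move=> N [<-|//]; exact: ts_top.
  by move=> l1 l2 ->; exact: embeds_insert.
Qed.

(** * Accessibility for the multiset extension *)

Definition sn_list : seq term -> Prop := Acc (fun l' l => list_red l l').

Lemma sn_list_embeds l k : embeds l k -> sn_list l -> sn_list k.
Proof.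
move=> H [Hl]; constructor=> m [M [Ns [k' [H1 H2 H3]]]]; apply: Hl.
by exists M, Ns, k'; split=> //; exact: embeds_trans H1.
Qed.

(** Outer induction on [M], inner induction on [l], according to which term the step replaces. *)
Lemma sn_list_cons M l :
  Acc (fun N P => thread_red P N) M -> sn_list l -> sn_list (M :: l).
Proof.
move=> HM; elim: HM l => {}M _ IHM l Hl; elim: Hl => {}l Hl IHl.
have {}Hl : sn_list l by constructor.
constructor=> l' [P [Ns [k [H1 H2 H3]]]].
(* If [M] was erased before the step, the step is one of [l] alone. *)
case: (@embeds_mid_inv [::] _ _ _ H1) => [H|[k1 [N [k2 [E HN H]]]]].
  by case: Hl => Hl; apply: Hl; exists P, Ns, k.
(* When [k1] is empty, [M] itself is replaced by its reducts [Ns], which the outer hypothesis adds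
   back one at a time. *)
case: k1 E H => [|P' k1] [E1 E2] H; subst.
  apply: (sn_list_embeds H3) => {H3}.
  have Hk : sn_list k2 := sn_list_embeds H Hl.
  elim: Ns H2 => [_|Q Ns IH H2] /=; first exact: Hk.
  by apply: IHM; [exists N => //; apply: H2; left | apply: IH => N' ?; apply: H2; right].
(* Otherwise the step happens in [l] and [M] survives beside it. *)
have Hred : list_red l (Ns ++ k1 ++ k2).
  by exists P', Ns, (k1 ++ k2); split=> //; exact: embeds_refl.
apply: sn_list_embeds (IHl _ Hred); apply: embeds_trans H3.
apply: (@embeds_trans _ (Ns ++ k1 ++ M :: k2)).
  by rewrite !(catA Ns); exact: embeds_insert.
apply: embeds_cat (embeds_refl _) _; apply: embeds_cat (embeds_refl _) _.
exact: (@emb_cons [::] k2) HN (embeds_refl _).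
Qed.

(** * Strong normalization of typed sums *)

Lemma step_list_red M N : step M N -> list_red (threads M) (threads N).
Proof.
case=> M' [N' [/sum_le_embeds HM /red_list_red [P [Ns [k [H1 H2 H3]]]] /sum_le_embeds HN]].
by exists P, Ns, k; split=> //; [exact: embeds_trans HM H1 | exact: embeds_trans H3 HN].
Qed.

Lemma sn_list_all l :
  (forall M, List.In M l -> Acc (fun N P => thread_red P N) M) -> sn_list l.
Proof.
elim: l => [|M l IH] H.
  constructor=> l' [P [Ns [k [H1 _ _]]]].
  by inversion H1 as [|[|? ?]].
by apply: sn_list_cons; [apply: H; left | apply: IH => N HN; apply: H; right].
Qed.

(** The identity substitution realizes the empty context, so a closed typed term is itself
    reducible; the condition on its final value can then be forgotten. *)
Lemma typed_thread_acc R M a e : wf_rctx R -> typed R [::] M a e ->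
  Acc (fun N P => thread_red P N) M.
Proof.
move=> HR HM.
have Hs : realizes R [::] Var by split=> // -[].
have := fundamental HR HM Hs; rewrite (subst_id _ (frefl Var)) => -[H1 H2].
apply: thread_acc (e_refl _) H1; first exact: sem_ref_eqv.
exact: computes_mono (fun r H => H) (fun v _ => I) H2.
Qed.

Lemma sum_typed_threads R G M a e : sum_typed R G M a e ->
  forall N, List.In N (threads M) -> typed R G N a e.
Proof.
elim=> {M a e} [M a e HM N [<-|//]|M N a e _ IHM _ IHN P] //=.
by case/In_cat; [exact: IHM | exact: IHN].
Qed.

Theorem mainTheorem1 (R : rctx) (M : tsum) (a : type) (e : effect)
    (hR : wf_rctx R) (hM : sum_typed R [::] M a e) :
  ~ (exists f : nat -> tsum, f 0 = M /\ forall n, step (f n) (f n.+1)).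
Proof.
case=> f [f0 Hf].
have H0 : sn_list (threads (f 0)).
  rewrite f0; apply: sn_list_all => N HN.
  exact: typed_thread_acc hR (sum_typed_threads hM HN).
(* The sequence [f] is generalized in the induction on accessibility, so that the hypothesis applies
   to its shift. *)
move E: (threads (f 0)) H0 => l H0.
elim: H0 f Hf E {f0} => {}l _ IH f Hf E; subst.
exact: IH (step_list_red (Hf 0)) (fun n => f n.+1) (fun n => Hf n.+1) erefl.
Qed.
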